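(* Let $\mathbb{K}$ be an algebraically closed field of characteristic zero, let $H$ be a unital affine (i.e. finitely generated) $\mathbb{K}$-algebra, and let $R \subset H$ be a central subalgebra such that $H$ is a free Frobenius extension of $R$. Assume that $R$ is regular, that $H$ is a prime ring, and that the centre $Z := Z(H)$ of $H$ is Gorenstein and integrally closed. Let $\mathfrak{m}$ be a maximal ideal of $R$ and let $A = H/\mathfrak{m}H$, a finite-dimensional split $\mathbb{K}$-algebra. Then $A$ has the rank-one property: if $A = A_1 \oplus \cdots \oplus A_k$ is the block decomposition of $A$ and $C_i$ denotes the Cartan matrix of the block $A_i$, then each $C_i$ has rank one over $\mathbb{Q}$.
   Context: Free Frobenius extension: a ring $H$ with a central subring $R$ is a free Frobenius extension of $R$ if $H$ is a free $R$-module of finite rank and there exist an $R$-linear ring automorphism $\alpha$ of $H$ and an isomorphism of $H$-bimodules ${}_1H_{\alpha^{-1}} \to \mathrm{Hom}_R(H,R)$. Here ${}_1H_{\alpha^{-1}}$ equals $H$ as a left $H$-module, with right action $h \cdot a = h\,\alpha^{-1}(a)$, and $\mathrm{Hom}_R(H,R)$ has the bimodule structure $(afb)(x) = f(bxa)$. Cartan matrix: let $K_0(A)$ be the Grothendieck group of finitely generated projective $A$-modules and $G_0(A)$ the Grothendieck group of all finitely generated $A$-modules. The Cartan map is the canonical map $C \colon K_0(A) \to G_0(A)$, $[P] \mapsto [P]$. If $\Lambda$ is a finite set parametrizing the isomorphism classes of simple $A$-modules, with representatives $L(\lambda)$ and projective covers $P(\lambda)$ for $\lambda \in \Lambda$,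 then $C$ is identified with the $|\Lambda| \times |\Lambda|$ matrix with entries the composition multiplicities $[P(\lambda):L(\mu)]$. The block decomposition $A = A_1 \oplus \cdots \oplus A_k$ is the decomposition into indecomposable two-sided ideals; correspondingly $C = C_1 \oplus \cdots \oplus C_k$, where $C_i$ is the Cartan matrix of $A_i$. *)

(* Defs.v *)
From HB Require Import structures.
From mathcomp Require Import all_boot all_algebra.
From mathcomp Require Import boolp ring.

Set Implicit Arguments.
Unset Strict Implicit.
Unset Printing Implicit Defensive.

Import GRing.Theory.
Local Open Scope ring_scope.
Local Open Scope quotient_scope.

(* Subsets are boolean predicates [{pred T}]; with the classical axioms of
   [boolp] this is no restriction, a [Prop]-valued predicate [P] being
   represented by [fun x => `[< P x >]].  Modules are left modules. *)

HB.mixin Record isTwoSided (R : pzRingType) (S : R -> bool) := {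
  idealMl_subproof : forall a x : R, x \in S -> a * x \in S;
  idealMr_subproof : forall a x : R, x \in S -> x * a \in S
}.

(* Unlike [ring_quotient.idealr], this allows the unit ideal. *)
#[short(type="ideal")]
HB.structure Definition Ideal (R : pzRingType) :=
  {S of GRing.ZmodClosed R S & isTwoSided R S}.

Section IdealTheory.
Variables (R : pzRingType) (I : ideal R).
Lemma idealMl (a x : R) : x \in I -> a * x \in I.
Proof. exact: idealMl_subproof. Qed.
Lemma idealMr (a x : R) : x \in I -> x * a \in I.
Proof. exact: idealMr_subproof. Qed.
End IdealTheory.

Definition maximal_ideal (R : pzRingType) (M : ideal R) : Prop :=
  1 \notin M /\
  forall J : ideal R, {subset M <= J} -> 1 \notin J -> {subset J <= M}.

(* [Quotient.quot I] is the additive quotient; [ring_quotient.v] gives it a ring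
   structure in the commutative case only. *)
Definition ring_quot (R : pzRingType) (I : ideal R) : Type :=
  Quotient.quot I.

Section RingQuot.
Variables (R : pzRingType) (I : ideal R).
HB.instance Definition _ :=
  GRing.Zmodule.copy (ring_quot I) (Quotient.quot I).
Local Notation Q := (Quotient.quot I).

Definition ring_proj (x : R) : ring_quot I := \pi_Q x.

Definition quot_mul (x y : ring_quot I) : ring_quot I :=
  ring_proj (repr (x : Q) * repr (y : Q)).

Lemma ring_projM (x y : R) :
  quot_mul (ring_proj x) (ring_proj y) = ring_proj (x * y).
Proof.
apply/eqP; rewrite /quot_mul /ring_proj -Quotient.idealrBE.
set x' := repr _; set y' := repr _.
have xI : x' - x \in I by rewrite Quotient.idealrBE reprK.
have yI : y' - y \in I by rewrite Quotient.idealrBE reprK.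
have -> : x' * y' - x * y = (x' - x) * y' + x * (y' - y).
  by rewrite mulrBl mulrBr addrA subrK.
by apply: rpredD; [apply: idealMr | apply: idealMl].
Qed.

Lemma ring_projD (x y : R) : ring_proj x + ring_proj y = ring_proj (x + y).
Proof. by rewrite /ring_proj (raddfD \pi_Q). Qed.

Lemma ring_quotP (x : ring_quot I) : exists y, x = ring_proj y.
Proof. by exists (repr (x : Q)); rewrite /ring_proj reprK. Qed.

Fact quot_mulA : associative quot_mul.
Proof.
move=> x y z.
have [[x' ->] [y' ->] [z' ->]] := And3 (ring_quotP x) (ring_quotP y) (ring_quotP z).
by rewrite !ring_projM mulrA.
Qed.
Fact quot_mul1r : left_id (ring_proj 1) quot_mul.
Proof. by move=> x; have [x' ->] := ring_quotP x; rewrite ring_projM mul1r. Qed.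
Fact quot_mulr1 : right_id (ring_proj 1) quot_mul.
Proof. by move=> x; have [x' ->] := ring_quotP x; rewrite ring_projM mulr1. Qed.
Fact quot_mulDl : left_distributive quot_mul +%R.
Proof.
move=> x y z.
have [[x' ->] [y' ->] [z' ->]] := And3 (ring_quotP x) (ring_quotP y) (ring_quotP z).
by rewrite ring_projD !ring_projM ring_projD mulrDl.
Qed.
Fact quot_mulDr : right_distributive quot_mul +%R.
Proof.
move=> x y z.
have [[x' ->] [y' ->] [z' ->]] := And3 (ring_quotP x) (ring_quotP y) (ring_quotP z).
by rewrite ring_projD !ring_projM ring_projD mulrDr.
Qed.

HB.instance Definition _ := GRing.Zmodule_isPzRing.Build (ring_quot I)
  quot_mulA quot_mul1r quot_mulr1 quot_mulDl quot_mulDr.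
End RingQuot.

(* A central subring of [H] is given by an injective ring morphism
   [iota : R -> H] with central image. *)
Definition central_map (R H : pzRingType) (iota : R -> H) : Prop :=
  forall (r : R) (x : H), iota r * x = x * iota r.

(* The ideal [m H], as the set of finite sums [\sum_i iota r_i * h_i] with
   the [r_i] in [m]; centrality makes it two-sided. *)
Section ExtendedIdeal.
Variables (R H : pzRingType) (iota : {rmorphism R -> H}).
Variable m : ideal R.

Definition ext_pred : {pred H} := fun x =>
  `[< exists2 s : seq (R * H), {in s, forall p, p.1 \in m} &
        x = \sum_(p <- s) iota p.1 * p.2 >].

Fact ext_zmod_closed : zmod_closed ext_pred.
Proof.
split=> [|x y /asboolP[s sm ->] /asboolP[t tm ->]]; apply/asboolP.
  by exists [::]; rewrite ?big_nil.
exists (s ++ [seq (p.1, - p.2) | p <- t]).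
  by move=> p; rewrite mem_cat => /orP[/sm//|/mapP[q /tm qm ->]].
rewrite big_cat big_map -sumrN; congr (_ + _).
by apply: eq_bigr => p _; rewrite mulrN.
Qed.

Hypothesis iota_central : central_map iota.

Fact ext_mull a x : x \in ext_pred -> a * x \in ext_pred.
Proof.
move=> /asboolP[s sm ->]; apply/asboolP.
exists [seq (p.1, a * p.2) | p <- s]; first by move=> p /mapP[q /sm qm ->].
rewrite big_map mulr_sumr; apply: eq_bigr => p _ /=.
by rewrite mulrA -iota_central -mulrA.
Qed.

Fact ext_mulr a x : x \in ext_pred -> x * a \in ext_pred.
Proof.
move=> /asboolP[s sm ->]; apply/asboolP.
exists [seq (p.1, p.2 * a) | p <- s]; first by move=> p /mapP[q /sm qm ->].
by rewrite big_map mulr_suml; apply: eq_bigr => p _ /=; rewrite mulrA.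
Qed.

Definition ext_ideal : ideal H :=
  HB.pack ext_pred (GRing.isZmodClosed.Build H ext_pred ext_zmod_closed)
    (isTwoSided.Build H ext_pred ext_mull ext_mulr).
End ExtendedIdeal.

Section Centre.
Variable H : pzRingType.

Definition centre_pred : {pred H} := fun z => `[< forall x, z * x = x * z >].

Fact centre_subring_closed : subring_closed centre_pred.
Proof.
split=> [|x y /asboolP xC /asboolP yC|x y /asboolP xC /asboolP yC];
  apply/asboolP=> z.
- by rewrite mul1r mulr1.
- by rewrite mulrBl mulrBr xC yC.
- by rewrite -mulrA yC mulrA xC mulrA.
Qed.
HB.instance Definition _ :=
  GRing.isSubringClosed.Build H centre_pred centre_subring_closed.

Record centre : Type := Centre { centre_val : H; _ : centre_val \in centre_pred }.
HB.instance Definition _ := [isSub for centre_val].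
HB.instance Definition _ := [Choice of centre by <:].
HB.instance Definition _ :=
  GRing.SubChoice_isSubPzRing.Build H centre_pred centre centre_subring_closed.

Fact centre_mulC : commutative (@GRing.mul centre).
Proof.
by move=> [x xC] [y yC]; apply/val_inj => /=; have /asboolP -> := xC.
Qed.
HB.instance Definition _ :=
  GRing.PzRing_hasCommutativeMul.Build centre centre_mulC.
End Centre.

(* [loc S] consists of the fractions a/s with [s] in the multiplicative set
   [S]; a/s = b/t iff u(at - bs) = 0 for some [u] in [S]. *)
Section Localization.
Variables (R : comPzRingType) (S : mulrClosed R).

Record den : Type := Den { den_val : R; _ : den_val \in S }.
HB.instance Definition _ := [isSub for den_val].
HB.instance Definition _ := [Choice of den by <:].

Definition frac : Type := (R * den)%type.
HB.instance Definition _ := Choice.on frac.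

Definition loc_equiv (x y : frac) : bool :=
  `[< exists2 u, u \in S & u * (x.1 * val y.2 - y.1 * val x.2) = 0 >].

Fact loc_equiv_is_equiv : equiv_class_of loc_equiv.
Proof.
have sym x y : loc_equiv x y -> loc_equiv y x.
  move=> /asboolP[u uS e]; apply/asboolP; exists u => //.
  by rewrite -opprB mulrN e oppr0.
split=> [x|x y|y x z].
- by apply/asboolP; exists 1; rewrite ?rpred1 // subrr mulr0.
- by apply/idP/idP; apply: sym.
- move=> /asboolP[u uS e] /asboolP[v vS f]; apply/asboolP.
  exists (u * v * val y.2); first by rewrite !rpredM ?(valP y.2).
  have -> : u * v * val y.2 * (x.1 * val z.2 - z.1 * val x.2) =
    v * val z.2 * (u * (x.1 * val y.2 - y.1 * val x.2)) +
    u * val x.2 * (v * (y.1 * val z.2 - z.1 * val y.2)) by ring.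
  by rewrite e f !mulr0 addr0.
Qed.

Canonical loc_equiv_equiv := EquivRelPack loc_equiv_is_equiv.
Canonical loc_encModRel := defaultEncModRel loc_equiv.

Definition loc : Type := {eq_quot loc_equiv}.
Local Notation Q := {eq_quot loc_equiv}.
HB.instance Definition _ := Choice.copy loc Q.

Definition den1 : den := Den (rpred1 S).
Definition denM (s t : den) : den := Den (rpredM (valP s) (valP t)).

Definition mkfrac (x : frac) : loc := \pi_Q x.
Definition loc_map (a : R) : loc := mkfrac (a, den1).

Definition frac_add (x y : frac) : frac :=
  (x.1 * val y.2 + y.1 * val x.2, denM x.2 y.2).
Definition frac_opp (x : frac) : frac := (- x.1, x.2).
Definition frac_mul (x y : frac) : frac := (x.1 * y.1, denM x.2 y.2).

Definition loc_add (x y : loc) : loc :=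
  mkfrac (frac_add (repr (x : Q)) (repr (y : Q))).
Definition loc_opp (x : loc) : loc := mkfrac (frac_opp (repr (x : Q))).
Definition loc_mul (x y : loc) : loc :=
  mkfrac (frac_mul (repr (x : Q)) (repr (y : Q))).

Lemma mkfracP (x y : frac) :
  mkfrac x = mkfrac y <->
  exists2 u, u \in S & u * (x.1 * val y.2 - y.1 * val x.2) = 0.
Proof. by split=> [/eqmodP/asboolP|/asboolP/(@eqmodP _ loc_equiv_equiv)]. Qed.

Lemma locP (x : loc) : exists y, x = mkfrac y.
Proof. by exists (repr (x : Q)); rewrite /mkfrac reprK. Qed.

Lemma repr_mkfrac (x : frac) : mkfrac (repr (mkfrac x : Q)) = mkfrac x.
Proof. by rewrite /mkfrac reprK. Qed.

Lemma mkfracD x y : loc_add (mkfrac x) (mkfrac y) = mkfrac (frac_add x y).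
Proof.
have /mkfracP[u uS e] := repr_mkfrac x; have /mkfracP[v vS f] := repr_mkfrac y.
apply/mkfracP; exists (u * v); rewrite ?rpredM //=.
move: e f; set x' := repr _; set y' := repr _.
case: x x' => [a s] [a' s']; case: y y' => [b t] [b' t'] /= e f.
have -> : u * v * ((a' * val t' + b' * val s') * (val s * val t) -
                   (a * val t + b * val s) * (val s' * val t')) =
  v * val t * val t' * (u * (a' * val s - a * val s')) +
  u * val s * val s' * (v * (b' * val t - b * val t')) by ring.
by rewrite e f !mulr0 addr0.
Qed.

Lemma mkfracN x : loc_opp (mkfrac x) = mkfrac (frac_opp x).
Proof.
have /mkfracP[u uS e] := repr_mkfrac x.
apply/mkfracP; exists u => //=.
by rewrite !mulNr -opprD mulrN e oppr0.
Qed.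

Lemma mkfracM x y : loc_mul (mkfrac x) (mkfrac y) = mkfrac (frac_mul x y).
Proof.
have /mkfracP[u uS e] := repr_mkfrac x; have /mkfracP[v vS f] := repr_mkfrac y.
apply/mkfracP; exists (u * v); rewrite ?rpredM //=.
move: e f; set x' := repr _; set y' := repr _.
case: x x' => [a s] [a' s']; case: y y' => [b t] [b' t'] /= e f.
have -> : u * v * (a' * b' * (val s * val t) - a * b * (val s' * val t')) =
  v * val t * b' * (u * (a' * val s - a * val s')) +
  u * a * val s' * (v * (b' * val t - b * val t')) by ring.
by rewrite e f !mulr0 addr0.
Qed.

Let frac_eq (x y : frac) : x.1 * val y.2 = y.1 * val x.2 -> mkfrac x = mkfrac y.
Proof. by move=> e; apply/mkfracP; exists 1; rewrite ?rpred1 // e subrr mulr0. Qed.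

Fact loc_addA : associative loc_add.
Proof.
move=> x y z; have [[x' ->] [y' ->] [z' ->]] := And3 (locP x) (locP y) (locP z).
by rewrite !mkfracD; apply: frac_eq => /=; ring.
Qed.
Fact loc_addC : commutative loc_add.
Proof.
move=> x y; have [[x' ->] [y' ->]] := conj (locP x) (locP y).
by rewrite !mkfracD; apply: frac_eq => /=; ring.
Qed.
Fact loc_add0r : left_id (loc_map 0) loc_add.
Proof.
by move=> x; have [x' ->] := locP x; rewrite mkfracD; apply: frac_eq => /=; ring.
Qed.
Fact loc_addNr : left_inverse (loc_map 0) loc_opp loc_add.
Proof.
move=> x; have [x' ->] := locP x.
by rewrite mkfracN mkfracD; apply: frac_eq => /=; ring.
Qed.
HB.instance Definition _ :=
  GRing.isZmodule.Build loc loc_addA loc_addC loc_add0r loc_addNr.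

Fact loc_mulA : associative loc_mul.
Proof.
move=> x y z; have [[x' ->] [y' ->] [z' ->]] := And3 (locP x) (locP y) (locP z).
by rewrite !mkfracM; apply: frac_eq => /=; ring.
Qed.
Fact loc_mulC : commutative loc_mul.
Proof.
move=> x y; have [[x' ->] [y' ->]] := conj (locP x) (locP y).
by rewrite !mkfracM; apply: frac_eq => /=; ring.
Qed.
Fact loc_mul1r : left_id (loc_map 1) loc_mul.
Proof.
by move=> x; have [x' ->] := locP x; rewrite mkfracM; apply: frac_eq => /=; ring.
Qed.
Fact loc_mulDl : left_distributive loc_mul loc_add.
Proof.
move=> x y z; have [[x' ->] [y' ->] [z' ->]] := And3 (locP x) (locP y) (locP z).
by rewrite mkfracD !mkfracM mkfracD; apply: frac_eq => /=; ring.
Qed.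
HB.instance Definition _ := GRing.Zmodule_isComPzRing.Build loc
  loc_mulA loc_mulC loc_mul1r loc_mulDl.
End Localization.

Record prime_ideal (R : comPzRingType) := PrimeIdeal {
  prime_carrier :> ideal R;
  prime_proper : 1 \notin prime_carrier;
  prime_mul : forall x y : R,
    x * y \in prime_carrier -> (x \in prime_carrier) || (y \in prime_carrier)
}.

Section LocalizationAtPrime.
Variables (R : comPzRingType) (P : prime_ideal R).
Definition prime_compl : {pred R} := fun x => x \notin P.
Fact prime_compl_closed : mulr_closed prime_compl.
Proof.
split=> [|x y]; first exact: prime_proper.
by rewrite !unfold_in => xP yP; apply/negP=> /prime_mul /orP[]; apply/negP.
Qed.
HB.instance Definition _ := GRing.isMulClosed.Build R prime_compl prime_compl_closed.
Definition loc_prime : comPzRingType := loc prime_compl.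
End LocalizationAtPrime.

Definition generates (R : comPzRingType) n (a : 'I_n -> R) (I : ideal R) : Prop :=
  forall x : R, x \in I <-> exists c : 'I_n -> R, x = \sum_i c i * a i.

Definition noetherian (R : comPzRingType) : Prop :=
  forall I : ideal R, exists n (a : 'I_n -> R), generates a I.

Definition prime_chain (R : comPzRingType) (d : nat) : Prop :=
  exists P : nat -> prime_ideal R, forall i, (i < d)%N ->
    {subset P i <= P i.+1} /\ ~ {subset P i.+1 <= P i}.

Definition krull_dim (R : comPzRingType) (d : nat) : Prop :=
  prime_chain R d /\ forall e, prime_chain R e -> (e <= d)%N.

Definition local_ring (R : comPzRingType) (M : ideal R) : Prop :=
  maximal_ideal M /\ forall M' : ideal R, maximal_ideal M' -> M' =i M.

Definition regular_local_ring (R : comPzRingType) : Prop :=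
  noetherian R /\
  exists M : ideal R, local_ring M /\
    exists d, krull_dim R d /\ exists a : 'I_d -> R, generates a M.

Definition regular_ring (R : comPzRingType) : Prop :=
  noetherian R /\ forall P : prime_ideal R, regular_local_ring (loc_prime P).

Definition injective_module (R : pzRingType) (E : lmodType R) : Prop :=
  forall (M N : lmodType R) (j : {linear M -> N}) (f : {linear M -> E}),
    injective j -> exists g : {linear N -> E}, forall x, g (j x) = f x.

(* An injective resolution 0 -> M -> E 0 -> E 1 -> ... -> E n -> 0. *)
Definition finite_injective_dimension (R : pzRingType) (M : lmodType R) : Prop :=
  exists (n : nat) (E : nat -> lmodType R) (eps : {linear M -> E 0})
         (d : forall i, {linear E i -> E i.+1}),
    [/\ forall i, injective_module (E i),
        forall i, (n < i)%N -> forall x : E i, x = 0,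
        injective eps,
        forall x, d 0 x = 0 <-> exists y, x = eps y
      & forall i x, d i.+1 x = 0 <-> exists y, x = d i y].

Definition gorenstein_local_ring (R : comPzRingType) : Prop :=
  [/\ noetherian R, exists M : ideal R, local_ring M
    & finite_injective_dimension (R^o : lmodType R)].

Definition gorenstein_ring (R : comPzRingType) : Prop :=
  noetherian R /\ forall P : prime_ideal R, gorenstein_local_ring (loc_prime P).

Definition integral_over_base (R : comPzRingType) (P : prime_ideal R)
    (x : loc_prime P) : Prop :=
  exists n (c : 'I_n -> R),
    x ^+ n + \sum_(i < n) loc_map (prime_compl P) (c i) * x ^+ i = 0.

(* [R] is a domain iff its zero ideal is prime; the localization at the zero
   ideal is then the field of fractions. *)
Definition integrally_closed_domain (R : comPzRingType) : Prop :=
  exists2 P0 : prime_ideal R, P0 =i pred1 0 &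
    forall x : loc_prime P0, integral_over_base x ->
      exists a, x = loc_map (prime_compl P0) a.

Definition affine_algebra (K : fieldType) (H : algType K) : Prop :=
  exists s : seq H, forall S : {pred H},
    subalg_closed S -> {subset s <= S} -> S =i predT.

Definition prime_ring (H : pzRingType) : Prop :=
  (1 : H) != 0 /\
  forall I J : ideal H, (forall x y, x \in I -> y \in J -> x * y = 0) ->
    {in I, forall x, x = 0} \/ {in J, forall y, y = 0}.

Section FreeFrobenius.
Variables (R H : pzRingType) (iota : {rmorphism R -> H}).

Definition free_finite_rank : Prop :=
  exists n (b : 'I_n -> H),
    (forall x, exists c : 'I_n -> R, x = \sum_i iota (c i) * b i) /\
    (forall c : 'I_n -> R, \sum_i iota (c i) * b i = 0 -> forall i, c i = 0).

(* The elements of [Hom_R(H, R)]. *)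
Definition base_linear (f : H -> R) : Prop :=
  forall r x y, f (iota r * x + y) = r * f x + f y.

(* [Phi] is the isomorphism of bimodules from [H], with right action
   [h . b = h * alphaV b] where [alphaV] is the inverse of [alpha], to
   [Hom_R(H, R)], with [(a f b) x = f (b * x * a)]. *)
Definition frobenius_iso (alphaV : H -> H) (Phi : H -> H -> R) : Prop :=
  [/\ forall h, base_linear (Phi h),
      forall h h' x, Phi (h + h') x = Phi h x + Phi h' x,
      (forall h h', Phi h =1 Phi h' -> h = h') /\
      (forall f, base_linear f -> exists h, Phi h =1 f),
      forall a h x, Phi (a * h) x = Phi h (x * a)
    & forall b h x, Phi (h * alphaV b) x = Phi h (b * x)].

Definition free_frobenius_extension : Prop :=
  free_finite_rank /\
  exists (alpha : {rmorphism H -> H}) (alphaV : H -> H) (Phi : H -> H -> R),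
    [/\ cancel alpha alphaV, cancel alphaV alpha,
        forall r x, alpha (iota r * x) = iota r * alpha x
      & frobenius_iso alphaV Phi].
End FreeFrobenius.

Section LmodQuot.
Variables (A : pzRingType) (M : lmodType A) (N : submodClosed M).

(* [submodClosed] does not record the closure under opposites required by
   [Quotient.quot]. *)
Definition submod_zmod : zmodClosed M :=
  HB.pack (N : {pred M}) (GRing.isZmodClosed.Build M (N : {pred M})
    (GRing.submod_closedB (submodClosedP N))).

Definition lmod_quot : Type := Quotient.quot submod_zmod.
Local Notation Q := (Quotient.quot submod_zmod).
HB.instance Definition _ := GRing.Zmodule.copy lmod_quot Q.

Definition lmod_proj (x : M) : lmod_quot := \pi_Q x.
Definition lmod_quot_scale (a : A) (x : lmod_quot) : lmod_quot :=
  lmod_proj (a *: repr (x : Q)).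

Lemma lmod_projZ a x : lmod_quot_scale a (lmod_proj x) = lmod_proj (a *: x).
Proof.
apply/eqP; rewrite /lmod_quot_scale /lmod_proj -Quotient.idealrBE -scalerBr.
have xN : repr (\pi_Q x) - x \in submod_zmod by rewrite Quotient.idealrBE reprK.
exact: (@rpredZ A M N a _ xN).
Qed.

Lemma lmod_projD x y : lmod_proj x + lmod_proj y = lmod_proj (x + y).
Proof. by rewrite /lmod_proj (raddfD \pi_Q). Qed.

Lemma lmod_quotP (x : lmod_quot) : exists y, x = lmod_proj y.
Proof. by exists (repr (x : Q)); rewrite /lmod_proj reprK. Qed.

Fact lmod_quot_scaleA a b x :
  lmod_quot_scale a (lmod_quot_scale b x) = lmod_quot_scale (a * b) x.
Proof. by have [x' ->] := lmod_quotP x; rewrite !lmod_projZ scalerA. Qed.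
Fact lmod_quot_scale1 : left_id 1 lmod_quot_scale.
Proof. by move=> x; have [x' ->] := lmod_quotP x; rewrite lmod_projZ scale1r. Qed.
Fact lmod_quot_scaleDr : right_distributive lmod_quot_scale +%R.
Proof.
move=> a x y; have [[x' ->] [y' ->]] := conj (lmod_quotP x) (lmod_quotP y).
by rewrite lmod_projD !lmod_projZ lmod_projD scalerDr.
Qed.
Fact lmod_quot_scaleDl x : {morph lmod_quot_scale^~ x : a b / a + b}.
Proof.
move=> a b; have [x' ->] := lmod_quotP x.
by rewrite !lmod_projZ lmod_projD scalerDl.
Qed.
HB.instance Definition _ := GRing.Zmodule_isLmodule.Build A lmod_quot
  lmod_quot_scaleA lmod_quot_scale1 lmod_quot_scaleDr lmod_quot_scaleDl.
End LmodQuot.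

Section Submodules.
Variables (A : pzRingType) (M : lmodType A) (N : submodClosed M).

Record submod : Type := Submod { submod_val : M; _ : submod_val \in N }.
HB.instance Definition _ := [isSub for submod_val].
HB.instance Definition _ := [Choice of submod by <:].
HB.instance Definition _ := [SubChoice_isSubLmodule of submod by <:].

Variable N' : submodClosed M.
Definition submod_restrict : {pred submod} := fun x => val x \in N'.
Fact submod_restrict_closed : submod_closed submod_restrict.
Proof.
have E x : (x \in submod_restrict) = (val x \in N') by [].
split=> [|a x y]; rewrite !E; first by rewrite raddf0 rpred0.
by move=> xN yN; rewrite linearP; apply: rpredD => //; apply: rpredZ.
Qed.
HB.instance Definition _ :=
  GRing.isSubmodClosed.Build A submod submod_restrict submod_restrict_closed.

(* [N / (N :&: N')], which is [N / N'] when [N'] is contained in [N]. *)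
Definition subquot : lmodType A := lmod_quot submod_restrict.
End Submodules.

Section CartanMatrix.
Variable A : pzRingType.
Implicit Types M N P L : lmodType A.

Definition lmod_isom M N : Prop := exists f : {linear M -> N}, bijective f.

Definition simple_module L : Prop :=
  (exists x : L, x != 0) /\
  forall N : submodClosed L, N =i pred1 0 \/ N =i predT.

Definition projective_module P : Prop :=
  forall M N (q : {linear M -> N}) (f : {linear P -> N}),
    (forall y, exists x, q x = y) ->
    exists g : {linear P -> M}, forall x, q (g x) = f x.

Definition projective_cover P L (p : {linear P -> L}) : Prop :=
  [/\ projective_module P,
      forall y, exists x, p x = y
    & forall N : submodClosed P,
        (forall x, exists2 y, y \in N & p (x - y) = 0) -> N =i predT].

(* [M] has a composition series with exactly [c] factors isomorphic to [L]. *)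
Definition composition_multiplicity M L (c : nat) : Prop :=
  exists (r : nat) (F : nat -> submodClosed M),
    [/\ F 0 =i pred1 0, F r =i predT,
        forall j, (j < r)%N ->
          {subset F j <= F j.+1} /\ simple_module (subquot (F j.+1) (F j))
      & c = #|[set j : 'I_r | `[< lmod_isom (subquot (F j.+1) (F j)) L >]]| ].

Definition simple_representatives n (L : 'I_n -> lmodType A) : Prop :=
  [/\ forall i, simple_module (L i),
      forall i j, lmod_isom (L i) (L j) -> i = j
    & forall M, simple_module M -> exists i, lmod_isom M (L i)].

Definition is_cartan_matrix n (C : 'M[nat]_n) : Prop :=
  exists (L P : 'I_n -> lmodType A) (p : forall i, {linear P i -> L i}),
    [/\ simple_representatives L,
        forall i, projective_cover (p i)
      & forall i j, composition_multiplicity (P i) (L j) (C i j)].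
End CartanMatrix.

Definition indecomposable_ideal (A : pzRingType) (I : ideal A) : Prop :=
  (exists2 x, x \in I & x != 0) /\
  forall J J' : ideal A, {subset J <= I} -> {subset J' <= I} ->
    {in I, forall x, exists y z, [/\ y \in J, z \in J' & x = y + z]} ->
    (forall x, x \in J -> x \in J' -> x = 0) ->
    {in J, forall x, x = 0} \/ {in J', forall x, x = 0}.

Record block_decomposition (A : pzRingType) := BlockDecomposition {
  nblocks : nat;
  block_ideal : 'I_nblocks -> ideal A;
  block_indecomposable : forall i, indecomposable_ideal (block_ideal i);
  block_span : forall a, exists2 c : 'I_nblocks -> A,
    forall i, c i \in block_ideal i & a = \sum_i c i;
  block_direct : forall c : 'I_nblocks -> A, (forall i, c i \in block_ideal i) ->
    \sum_i c i = 0 -> forall i, c i = 0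
}.

(* The ring [A_i]: its elements are those of the ideal, its unit is the i-th
   component of [1 : A]. *)
Section BlockRing.
Variables (A : pzRingType) (D : block_decomposition A) (i : 'I_(nblocks D)).
Local Notation I := (@block_ideal A D).

Record block : Type := Block { block_val : A; _ : block_val \in I i }.
HB.instance Definition _ := [isSub for block_val].
HB.instance Definition _ := [Choice of block by <:].
HB.instance Definition _ := [SubChoice_isSubZmodule of block by <:].

Definition one_component : 'I_(nblocks D) -> A := sval (cid2 (block_span D 1)).

Lemma one_component_in j : one_component j \in I j.
Proof. by rewrite /one_component; case: cid2. Qed.
Lemma sum_one_component : \sum_j one_component j = 1.
Proof. by rewrite /one_component; case: cid2. Qed.

Lemma block_component (x : A) (c : 'I_(nblocks D) -> A) :
  x \in I i -> (forall j, c j \in I j) -> \sum_j c j = x -> c i = x.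
Proof.
move=> xI cI e; pose c' j := c j - (if j == i then x else 0).
suff /(_ i) : forall j, c' j = 0 by rewrite /c' eqxx => /eqP; rewrite subr_eq0 => /eqP.
apply: block_direct => [j|].
  by apply: rpredB => //; case: eqP => [->//|_]; apply: rpred0.
by rewrite sumrB e -big_mkcond big_pred1_eq subrr.
Qed.

Lemma block_mul1 (x : A) : x \in I i -> one_component i * x = x.
Proof.
move=> xI; apply: (block_component (c := fun j => one_component j * x)) => // [j|].
  exact/idealMr/one_component_in.
by rewrite -mulr_suml sum_one_component mul1r.
Qed.

Lemma block_mulr1 (x : A) : x \in I i -> x * one_component i = x.
Proof.
move=> xI; apply: (block_component (c := fun j => x * one_component j)) => // [j|].
  exact/idealMl/one_component_in.
by rewrite -mulr_sumr sum_one_component mulr1.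
Qed.

Definition block_one : block := Block (one_component_in i).
Definition block_mul (x y : block) : block := Block (idealMl (val x) (valP y)).

Fact block_mulA : associative block_mul.
Proof. by move=> x y z; apply/val_inj/mulrA. Qed.
Fact block_mul1l : left_id block_one block_mul.
Proof. by move=> x; apply/val_inj/block_mul1/valP. Qed.
Fact block_mul1r : right_id block_one block_mul.
Proof. by move=> x; apply/val_inj/block_mulr1/valP. Qed.
Fact block_mulDl : left_distributive block_mul +%R.
Proof. by move=> x y z; apply/val_inj/mulrDl. Qed.
Fact block_mulDr : right_distributive block_mul +%R.
Proof. by move=> x y z; apply/val_inj/mulrDr. Qed.
HB.instance Definition _ := GRing.Zmodule_isPzRing.Build block
  block_mulA block_mul1l block_mul1r block_mulDl block_mulDr.
End BlockRing.

Definition rank_one_property (A : pzRingType) : Prop :=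
  forall (D : block_decomposition A) (i : 'I_(nblocks D)) (n : nat)
         (C : 'M[nat]_n),
    is_cartan_matrix (block i : pzRingType) C ->
    \rank (map_mx (fun c : nat => c%:R : rat) C) = 1%N.

(* Main.v *)
From HB Require Import structures.
Require Import Defs.
From mathcomp Require Import all_boot all_algebra all_field.
From mathcomp Require Import boolp classical_sets ring zify.

Set Implicit Arguments.
Unset Strict Implicit.
Unset Printing Implicit Defensive.

Import GRing.Theory.
Local Open Scope ring_scope.

(** Write [T(a, b)] for the trace of [x |-> a * x * b]: over [R] on the free module
    [H], and over the residue field [k = R/m] on [A = H/mH]. The second is the
    reduction of the first.

    Let [Z] be the centre of [H], [F] its fraction field and [N] the dimension of
    [H] over [F] after inverting the nonzero elements of [Z]. As [H] is prime of
    characteristic zero, the form [tr (x * y)] over [F] is nondegenerate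
    ([trace_form_nondegenerate]). The orthogonal of the commutators for this
    form is [F], so the elements of trace zero are exactly the combinations of
    commutators ([trace0_sum_commutators]). The trace [t] of an element [b]
    of [H] is integral over [R] ([mxtrace_integral]), hence lies in [Z], which is
    integrally closed; and [N b - t] has trace zero, so it is a combination of
    commutators. But [T(a, _)] kills commutators, whence
    [N T(a, b) = T(a, t)] with [t] central ([bitrace_central_part]).

    This relation passes to [A]: every [b] in [A] has a central [t] with
    [N T(a, b) = T(a, t)] for all [a]. Let [e] be an idempotent of a block with
    unit [c]; then [t] may be taken in the centre of the block, where every
    element is primary ([central_primary]). Comparing traces shows that [t] is a
    rational multiple of [c] up to a nilpotent, so that [T(a, e)] is
    [T(a, c)] times a rational number independent of [a] ([bitrace_idem]). In
    other words the characters of all the projective modules [A e] of the block are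
    proportional to each other.

    Finally, if [P_i = B e_i] is the projective cover of [L_i] over the block [B],
    then [T(e_j, e_i)] is the dimension of [e_j P_i], which is
    the dimension of [e_j L_j] times the multiplicity of [L_j] in [P_i]
    ([composition_dim], [bitrace_has_dim]). So the rows of the Cartan matrix are
    proportional, and its diagonal entries are positive ([cartan_rank1]). *)

(** * Traces of matrices over a field *)

Lemma irreducible_factor (F : fieldType) (p : {poly F}) :
  (1 < size p)%N -> exists2 q : {poly F}, irreducible_poly q & q %| p.
Proof.
have [n] := ubnP (size p); elim: n p => // n IHn p lepn p_gt1.
have [p_irr|p_red] := pselect (irreducible_poly p); first by exists p.
have [q [q1 qp qNp]] : exists q : {poly F}, [/\ size q != 1, q %| p & ~ (q %= p)].
  apply: contrapT => no_q; apply: p_red; split=> // q q1 qp.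
  by apply: contrapT => qNp; apply: no_q; exists q.
have p0 : p != 0 by rewrite -size_poly_gt0 ltnW.
have q0 : q != 0 by apply: contraNneq p0 => q0; rewrite q0 dvd0p in qp.
have ltqp : (size q < size p)%N.
  rewrite ltn_neqAle dvdp_leq // andbT; apply: contra_notN qNp => /eqP eqs.
  by rewrite -(dvdp_size_eqp qp) eqs.
have [|r r_irr rq] := IHn q (leq_trans ltqp lepn).
  by rewrite ltn_neqAle eq_sym q1 size_poly_gt0.
by exists r => //; apply: dvdp_trans qp.
Qed.

Lemma root_in_extension (F : fieldType) (p : {poly F}) :
  (1 < size p)%N ->
  exists (L : fieldType) (f : {rmorphism F -> L}) (x : L), root (map_poly f p) x.
Proof.
case/irreducible_factor => q q_irr /dvdpP[r ->].
have [L _ [x qx _]] := irredp_FAdjoin q_irr.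
by exists L, (in_alg L), x; rewrite rmorphM rootM qx orbT.
Qed.

Lemma monic_size_le1 (S : nzRingType) (p : {poly S}) :
  p \is monic -> (size p <= 1)%N -> p = 1.
Proof.
move=> /monicP p_mon p1; rewrite (size1_polyC p1); congr (_%:P).
by rewrite -[RHS]p_mon lead_coefE; case: (size p) p1 => [|[|]].
Qed.

Lemma splitting_extension (F : fieldType) (p : {poly F}) : p \is monic ->
  exists (L : fieldType) (f : {rmorphism F -> L}) (s : seq L),
    map_poly f p = \prod_(x <- s) ('X - x%:P).
Proof.
have [n] := ubnP (size p); elim: n F p => // n IHn F p lepn p_mon.
have [p1|p_gt1] := leqP (size p) 1.
  exists F, idfun, [::]; rewrite big_nil map_poly_id //.
  exact: monic_size_le1.
have [F1 [f [x]]] := root_in_extension p_gt1.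
case/factor_theorem => r def_p.
have r_mon : r \is monic.
  by rewrite -(monicMr _ (monicXsubC x)) -def_p map_monic.
have [|L [g [s def_r]]] := IHn F1 r _ r_mon.
  have := congr1 (fun q : {poly F1} => size q) def_p.
  rewrite size_map_poly size_Mmonic ?monicXsubC ?monic_neq0 // size_XsubC.
  by rewrite addn2 /= => <-.
exists L, (g \o f), (g x :: s).
by rewrite map_poly_comp def_p rmorphM /= def_r map_polyXsubC big_cons mulrC.
Qed.

Lemma eigenvector_horner (F : fieldType) n (M : 'M[F]_n.+1) (v : 'rV_n.+1) a p :
  v *m M = a *: v -> v *m horner_mx M p = p.[a] *: v.
Proof.
move=> va; elim/poly_ind: p => [|p c IHp].
  by rewrite rmorph0 mulmx0 horner0 scale0r.
rewrite rmorphD rmorphM /= horner_mx_X horner_mx_C mulmxDr mulmxA IHp.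
by rewrite -scalemxAl va scalerA mul_mx_scalar hornerMXaddC scalerDl.
Qed.

Lemma horner_mxE (S : comNzRingType) n (M : 'M[S]_n.+1) (p : {poly S}) :
  horner_mx M p = \sum_(i < size p) p`_i *: M ^+ i.
Proof.
rewrite -{1}[p]coefK poly_def raddf_sum; apply: eq_bigr => i _.
by rewrite /= horner_mxZ rmorphXn /= horner_mx_X.
Qed.

(** Over a splitting field of the characteristic polynomial the trace is the
    sum of the eigenvalues, each of which is a root of every polynomial that
    annihilates the matrix. *)
Lemma mxtrace_integral (S : comNzRingType) (F : fieldType)
    (g : {rmorphism S -> F}) n (M : 'M[F]_n.+1) (p : {poly S}) :
  p \is monic -> horner_mx M (map_poly g p) = 0 -> integralOver g (\tr M).
Proof.
move=> p_mon pM0.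
have [L [f [s def_s]]] := splitting_extension (char_poly_monic M).
have size_s : size s = n.+1.
  have := congr1 (fun q : {poly L} => size q) def_s.
  by rewrite size_map_poly size_char_poly size_prod_XsubC => -[].
have tr_s : f (\tr M) = \sum_(x <- s) x.
  apply: oppr_inj; rewrite -rmorphN -char_poly_trace // -coef_map def_s.
  by rewrite -[RHS]coefPn_prod_XsubC size_s.
have int_s : {in s, forall x, integralOver (f \o g) x}.
  move=> x xs; exists p => //.
  have : eigenvalue (map_mx f M) x.
    by rewrite eigenvalue_root_char -map_char_poly def_s root_prod_XsubC.
  case/eigenvalueP => v /eigenvector_horner vx v0.
  have := vx (map_poly f (map_poly g p)).
  rewrite -map_horner_mx pM0 map_mx0 mulmx0 -map_poly_comp => /esym/eqP.
  by rewrite scaler_eq0 (negPf v0) orbF.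
have [q q_mon] : integralOver (f \o g) (f (\tr M)).
  rewrite tr_s big_seq; apply: (big_ind (integralOver (f \o g))) => //.
  - exact: integral0.
  - by move=> x y; apply: integral_add.
by rewrite map_poly_comp fmorph_root; exists q.
Qed.

(** As no divisor is coprime to [q], one can divide by [q] until the constant
    [1] is left. This avoids unique factorization. *)
Lemma eq_expr_of_divisors (F : fieldType) (q p : {poly F}) :
    q \is monic -> irreducible_poly q -> p \is monic ->
    (forall h : {poly F}, (1 < size h)%N -> h %| p -> ~~ coprimep h q) ->
  exists r, p = q ^+ r.
Proof.
move=> q_mon q_irr; have [n] := ubnP (size p); elim: n p => // n IHn p lepn.
move=> p_mon noncop; have [p1|p_gt1] := leqP (size p) 1.
  by exists 0; apply: monic_size_le1.
have := noncop p p_gt1 (dvdpp p).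
rewrite coprimep_sym irreducible_poly_coprime // negbK => /dvdpP[p1 def_p].
have p1_mon : p1 \is monic by rewrite -(monicMr _ q_mon) -def_p.
have [||r def_p1] := IHn p1 _ p1_mon.
- have [q_gt1 _] := q_irr; move: lepn.
  rewrite def_p size_Mmonic ?monic_neq0 //; move: q_gt1.
  by case: (size q) => [|[|s]] //= _; rewrite !addnS /= !ltnS; apply/leq_trans/leq_addr.
- by move=> h h_gt1 hp1; apply: noncop => //; rewrite def_p dvdp_mulr.
by exists r.+1; rewrite exprSr -def_p1.
Qed.

(** The coefficient of [p] next to the leading one; multiplying by ['X] gives
    the value [0] when [p] is constant. *)
Definition subcoef (S : nzRingType) (p : {poly S}) : S := ('X * p)`_(size p).-1.

Lemma subcoefM (F : idomainType) (p q : {poly F}) : p \is monic -> q \is monic ->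
  subcoef (p * q) = subcoef p + subcoef q.
Proof.
move=> p_mon q_mon.
have [p1|] := leqP (size p) 1.
  by rewrite (monic_size_le1 p_mon) // mul1r /subcoef mulr1 size_poly1 coefX add0r.
have [q1|] := leqP (size q) 1.
  by rewrite (monic_size_le1 q_mon) // mulr1 /subcoef mulr1 size_poly1 coefX addr0.
have := monicP q_mon; have := monicP p_mon; rewrite /subcoef !lead_coefE.
rewrite (size_Mmonic (monic_neq0 p_mon) q_mon) !coefXM.
have pge i : (size p <= i)%N -> p`_i = 0 by move=> ?; rewrite nth_default.
have qge i : (size q <= i)%N -> q`_i = 0 by move=> ?; rewrite nth_default.
case: (size p) pge => [|[|a]] //; case: (size q) qge => [|[|b]] //= qge pge pa qb _ _.
rewrite !addnS /= addnC coefM.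
have lta : (a < (b + a).+2)%N by lia.
have ltSa : (a.+1 < (b + a).+2)%N by lia.
rewrite (bigD1 (Ordinal lta)) //= (bigD1 (Ordinal ltSa)) /=; last first.
  by rewrite -val_eqE /= eqn_leq ltnn.
rewrite subSS addnK (_ : (b + a).+1 - a = b.+1)%N; last by lia.
rewrite qb mulr1 pa mul1r big1 ?addr0 // => j /andP[].
rewrite -!val_eqE /= => ja jSa.
have [ltja|lejb] := ltnP j a.
  by rewrite [X in _ * X]qge ?mulr0 //; lia.
by rewrite pge ?mul0r //; lia.
Qed.

Lemma subcoefX (F : idomainType) (q : {poly F}) r : q \is monic ->
  subcoef (q ^+ r) = subcoef q *+ r.
Proof.
move=> q_mon; elim: r => [|r IHr].
  by rewrite expr0 /subcoef mulr1 size_poly1 coefX.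
by rewrite exprS subcoefM ?rpredX // IHr mulrS.
Qed.

(** The characteristic polynomial of a matrix killed by a power of an irreducible
    polynomial [q] is a power of [q], since every eigenvalue is a root of [q].
    So the average of the eigenvalues is that of the roots of [q], whatever
    the size of the matrix. *)
Lemma mxtrace_primary (F : fieldType) (q : {poly F}) e n (M : 'M[F]_n.+1) :
    q \is monic -> irreducible_poly q -> horner_mx M (q ^+ e) = 0 ->
  \tr M *+ (size q).-1 = - subcoef q *+ n.+1.
Proof.
move=> q_mon q_irr qM0.
have [r def_r] : exists r, char_poly M = q ^+ r.
  apply: eq_expr_of_divisors => // [|h h_gt1 h_dv]; first exact: char_poly_monic.
  apply/negP => cop.
  have [L [f [x hx]]] := root_in_extension h_gt1.
  have : eigenvalue (map_mx f M) x.
    rewrite eigenvalue_root_char -map_char_poly.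
    by case/dvdpP: h_dv => g ->; rewrite rmorphM rootM hx orbT.
  case/eigenvalueP => v /eigenvector_horner vx v0.
  have := vx (map_poly f (q ^+ e)).
  rewrite -map_horner_mx qM0 map_mx0 mulmx0 rmorphXn horner_exp => /esym/eqP.
  rewrite scaler_eq0 (negPf v0) orbF expf_eq0 => /andP[_].
  by rewrite (negPf (coprimep_root _ hx)) // coprimep_map.
have size_r : (n.+1 = (size q).-1 * r)%N.
  have := size_char_poly M; rewrite def_r => e1.
  by rewrite -[LHS]/(n.+2.-1) -e1 size_exp.
have -> : \tr M = - subcoef (char_poly M).
  by rewrite /subcoef size_char_poly coefXM /= char_poly_trace // opprK.
by rewrite def_r subcoefX // size_r mulnC !mulNrn mulrnA.
Qed.

(** An idempotent is the projection onto its row space: the full rank factors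
    compose to the identity in the other order. *)
Lemma idmx_factor (F : fieldType) n (E : 'M[F]_n) : E *m E = E ->
  row_base E *m col_base E = 1%:M.
Proof.
move=> EE; have := row_base_free E; have := col_base_full E; have := mulmx_base E.
move: (col_base E) (row_base E) => C B CB C_full B_free.
apply: (row_free_inj B_free); apply: (row_full_inj C_full).
by rewrite mul1mx !mulmxA CB -mulmxA CB.
Qed.

Lemma mxtrace_idem (F : fieldType) n (E : 'M[F]_n) : E *m E = E ->
  \tr E = (\rank E)%:R.
Proof.
by move=> EE; rewrite -{1}(mulmx_base E) mxtrace_mulC idmx_factor // mxtrace1.
Qed.

(** [mxtrace_primary] for the restriction of [M] to the image of an idempotent
    commuting with [M]. *)
Lemma mxtrace_primary_idem (F : fieldType) (q : {poly F}) e n (M E : 'M[F]_n.+1) :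
    q \is monic -> irreducible_poly q -> E *m E = E -> M *m E = E *m M ->
    horner_mx M (q ^+ e) *m E = 0 ->
  \tr (M *m E) *+ (size q).-1 = - subcoef q * \tr E.
Proof.
move=> q_mon q_irr EE ME qM0.
rewrite (mxtrace_idem EE); move: (idmx_factor EE) (mulmx_base E).
move: (col_base E) (row_base E).
case: (\rank E) => [|r] U W WU UW.
  by rewrite -UW (flatmx0 W) !mulmx0 mxtrace0 mul0rn mulr0.
rewrite mulr_natr -UW mulmxA mxtrace_mulC.
(* [W *m (M *m U)] is the matrix of [M] on the image of [E]. *)
have hornerG p : horner_mx (W *m (M *m U)) p = W *m (horner_mx M p *m U).
  elim/poly_ind: p => [|p c IHp]; first by rewrite !rmorph0 mul0mx mulmx0.
  rewrite !rmorphD !rmorphM /= !horner_mx_X !horner_mx_C mulmxDl mulmxDr IHp.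
  rewrite mul_scalar_mx -scalemxAr WU scalemx1; congr (_ + _).
  have EMU : U *m (W *m (M *m U)) = M *m U.
    by rewrite !mulmxA UW -ME -mulmxA -UW -mulmxA WU mulmx1.
  by rewrite -mulmxE -!mulmxA EMU.
apply: (mxtrace_primary (e := e)) => //.
rewrite hornerG.
have -> : U = E *m U by rewrite -UW -mulmxA WU mulmx1.
by rewrite (mulmxA _ E) qM0 mul0mx mulmx0.
Qed.

Lemma mxtrace_nilpotent (F : fieldType) n (M : 'M[F]_n.+1) e :
  M ^+ e = 0 -> \tr M = 0.
Proof.
move=> Me0.
have X_irr : irreducible_poly ('X : {poly F}).
  split=> [|q q1 /dvdpP[r defX]]; first by rewrite size_polyX.
  have r0 : r != 0 by apply: contra_eq_neq defX => ->; rewrite mul0r polyX_eq0.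
  have q0 : q != 0 by apply: contra_eq_neq defX => ->; rewrite mulr0 polyX_eq0.
  rewrite -dvdp_size_eqp ?defX ?dvdp_mull // -defX size_polyX.
  move: (congr1 (fun p : {poly F} => size p) defX).
  rewrite size_polyX size_mul //; move: q1 r0 q0; rewrite -!size_poly_gt0.
  by move: (size r) (size q) => [|a] [|[|[|b]]] //=; lia.
have := mxtrace_primary (e := e) (M := M) (monicX F) X_irr.
rewrite rmorphXn /= horner_mx_X => /(_ Me0).
by rewrite size_polyX mulr1n /subcoef size_polyX -expr2 coefXn mulNrn mul0rn oppr0.
Qed.

(** By Cayley-Hamilton, power traces that all vanish force the constant term of
    the characteristic polynomial to vanish as well. *)
Lemma mxtrace_pow0_nunit (F : fieldType) n (G : 'M[F]_n.+1) :
  [pchar F] =i pred0 -> (forall i, \tr (G ^+ i.+1) = 0) -> G \notin unitmx.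
Proof.
move=> /pcharf0P F0 trG.
have := congr1 mxtrace (Cayley_Hamilton G).
rewrite horner_mxE size_char_poly big_ord_recl raddfD raddf_sum big1 /=; last first.
  by move=> i _; rewrite mxtraceZ trG mulr0.
rewrite addr0 expr0 mxtraceZ mxtrace1 mxtrace0 char_poly_det => /eqP.
rewrite !mulf_eq0 signr_eq0 F0 orbF /= unitmxE => /eqP ->.
by rewrite unitr0.
Qed.

(** * Rings with coordinates and the trace of x |-> a x b *)

Definition central (A : pzRingType) (z : A) : Prop := forall x, z * x = x * z.

(** Coordinates of a ring [A] over [F] that need not be onto: for a prime ring
    with centre [Z] and [F] the fraction field of [Z], only the vectors with
    suitable denominators are the coordinates of an element. *)
Record coords (F : comNzRingType) (A : nzRingType) (n : nat) := Coords {
  co :> A -> 'rV[F]_n.+1;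
  cb : 'I_n.+1 -> A;
  coB : zmod_morphism co;
  co_inj : injective co;
  co_cb : forall i, co (cb i) = delta_mx 0 i;
  co_mulr : forall x a, co (x * a) = \sum_i co x 0 i *: co (cb i * a);
  co_mull : forall x a, co (a * x) = \sum_i co x 0 i *: co (a * cb i)
}.

Section BiTrace.
Variables (F : comNzRingType) (A : nzRingType) (n : nat) (C : coords F A n).

HB.instance Definition _ := GRing.isZmodMorphism.Build A 'rV[F]_n.+1 C (coB C).

Definition Rm (a : A) : 'M[F]_n.+1 := \matrix_i C (cb C i * a).
Definition Lm (a : A) : 'M[F]_n.+1 := \matrix_i C (a * cb C i).

Lemma co_Rm x a : C (x * a) = C x *m Rm a.
Proof.
by rewrite co_mulr mulmx_sum_row; apply: eq_bigr => i _; rewrite rowK.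
Qed.

Lemma co_Lm a x : C (a * x) = C x *m Lm a.
Proof.
by rewrite co_mull mulmx_sum_row; apply: eq_bigr => i _; rewrite rowK.
Qed.

Fact RmB : zmod_morphism Rm.
Proof.
move=> a b; apply/row_matrixP => i.
by rewrite linearB /= !rowK mulrBr raddfB.
Qed.
HB.instance Definition _ := GRing.isZmodMorphism.Build A 'M[F]_n.+1 Rm RmB.

Fact LmB : zmod_morphism Lm.
Proof.
move=> a b; apply/row_matrixP => i.
by rewrite linearB /= !rowK mulrBl raddfB.
Qed.
HB.instance Definition _ := GRing.isZmodMorphism.Build A 'M[F]_n.+1 Lm LmB.

Fact Rm_monoid : monoid_morphism Rm.
Proof.
split=> [|a b]; apply/row_matrixP => i.
  by rewrite rowK mulr1 co_cb row1.
by rewrite rowK mulrA co_Rm -mulmxE row_mul rowK.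
Qed.
HB.instance Definition _ := GRing.isMonoidMorphism.Build A 'M[F]_n.+1 Rm Rm_monoid.

Lemma RmM a b : Rm (a * b) = Rm a *m Rm b. Proof. exact: rmorphM. Qed.

Lemma LmM a b : Lm (a * b) = Lm b *m Lm a.
Proof.
by apply/row_matrixP => i; rewrite rowK -mulrA co_Lm row_mul rowK.
Qed.

Lemma Lm1 : Lm 1 = 1%:M.
Proof. by apply/row_matrixP => i; rewrite rowK mul1r co_cb row1. Qed.

Lemma Lm_central z : central z -> Lm z = Rm z.
Proof. by move=> zC; apply/row_matrixP => i; rewrite !rowK zC. Qed.

Lemma Lm_Rm a b : Lm a *m Rm b = Rm b *m Lm a.
Proof.
by apply/row_matrixP => i; rewrite !row_mul !rowK -co_Rm -co_Lm mulrA.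
Qed.

Lemma Rm_inj a b : Rm a = Rm b -> a = b.
Proof.
by move=> eRm; apply: (@co_inj _ _ _ C); rewrite -[a]mul1r -[b]mul1r !co_Rm eRm.
Qed.

(** The trace of [x |-> a * x * b]. *)
Definition bitrace (a b : A) : F := \tr (Lm a *m Rm b).

Lemma bitraceBl a a' b : bitrace (a - a') b = bitrace a b - bitrace a' b.
Proof. by rewrite /bitrace raddfB mulmxBl raddfB. Qed.

Lemma bitraceBr a b b' : bitrace a (b - b') = bitrace a b - bitrace a b'.
Proof. by rewrite /bitrace raddfB mulmxBr raddfB. Qed.

Lemma bitrace_sumr I (r : seq I) a (u : I -> A) :
  bitrace a (\sum_(i <- r) u i) = \sum_(i <- r) bitrace a (u i).
Proof. by rewrite /bitrace raddf_sum mulmx_sumr raddf_sum. Qed.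

Lemma bitraceMnr a b k : bitrace a (b *+ k) = bitrace a b *+ k.
Proof. by rewrite /bitrace raddfMn -scaler_nat -scalemxAr mxtraceZ mulr_natl. Qed.

Lemma bitrace1 b : bitrace 1 b = \tr (Rm b).
Proof. by rewrite /bitrace Lm1 mul1mx. Qed.

(** The operators of left and right multiplication commute, so this is the
    symmetry of the trace. *)
Lemma bitraceC a b c : bitrace a (b * c) = bitrace a (c * b).
Proof.
by rewrite /bitrace !RmM mulmxA mxtrace_mulC (mulmxA (Rm c)) -Lm_Rm -mulmxA.
Qed.

Lemma bitrace_central z a b : central z -> bitrace (z * a) b = bitrace a (z * b).
Proof.
move=> zC; rewrite zC /bitrace LmM RmM Lm_central // [in RHS]mulmxA.
by rewrite -Lm_Rm.
Qed.

Definition acts_as (z : A) (c : F) : Prop :=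
  central z /\ forall x, C (z * x) = c *: C x.

Lemma Rm_acts z c a : acts_as z c -> Rm (z * a) = c *: Rm a.
Proof.
move=> [zC zc]; apply/row_matrixP => i.
by rewrite linearZ /= !rowK mulrA -zC -mulrA zc.
Qed.

Lemma Rm_scalar z c : acts_as z c -> Rm z = c%:M.
Proof. by move=> zc; rewrite -[z]mulr1 (Rm_acts _ zc) rmorph1 -scalemx1. Qed.

Lemma bitraceZr z c a b : acts_as z c -> bitrace a (z * b) = c * bitrace a b.
Proof. by move=> zc; rewrite /bitrace (Rm_acts _ zc) -scalemxAr mxtraceZ. Qed.

Lemma bitraceZl z c a b : acts_as z c -> bitrace (z * a) b = c * bitrace a b.
Proof. by move=> zc; rewrite bitrace_central ?(bitraceZr _ _ zc) //; case: zc. Qed.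

End BiTrace.

Section FreeCoords.
Variables (S : comNzRingType) (A : nzRingType) (kap : {rmorphism S -> A}).
Hypothesis kapC : central_map kap.
Variables (n : nat) (b : 'I_n.+1 -> A).
Hypothesis b_span : forall x, exists c : 'I_n.+1 -> S, x = \sum_i kap (c i) * b i.
Hypothesis b_free : forall c : 'I_n.+1 -> S,
  \sum_i kap (c i) * b i = 0 -> forall i, c i = 0.

(** On a free algebra the coordinates with respect to a basis are onto. *)
Lemma free_coords : exists C : coords S A n,
  [/\ cb C = b, forall r, acts_as C (kap r) r
    & forall x, x = \sum_i kap (C x 0 i) * b i].
Proof.
have /choice[c cE] x : exists c : 'rV[S]_n.+1, x = \sum_i kap (c 0 i) * b i.
  have [d ->] := b_span x.
  by exists (\row_i d i); apply: eq_bigr => i _; rewrite mxE.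
have c_uniq x (v : 'rV_n.+1) : x = \sum_i kap (v 0 i) * b i -> c x = v.
  move=> xv; apply/rowP => i; apply/eqP; rewrite -subr_eq0; apply/eqP.
  apply: (b_free (c := fun i => c x 0 i - v 0 i)).
  under eq_bigr do rewrite rmorphB mulrBl.
  by rewrite sumrB -cE -xv subrr.
have cB : zmod_morphism c.
  move=> x y; apply: c_uniq.
  under eq_bigr do rewrite !mxE rmorphB mulrBl.
  by rewrite sumrB -!cE.
have c_inj : injective c by move=> x y exy; rewrite (cE x) exy -cE.
have cZ r x : c (kap r * x) = r *: c x.
  apply: c_uniq; rewrite {1}(cE x) mulr_sumr; apply: eq_bigr => i _.
  by rewrite mxE rmorphM mulrA.
have c_b i : c (b i) = delta_mx 0 i.
  apply: c_uniq; rewrite (bigD1 i) //= mxE !eqxx rmorph1 mul1r big1 ?addr0 //.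
  by move=> j ji; rewrite mxE (negPf ji) andbF rmorph0 mul0r.
have csum (u : 'I_n.+1 -> A) : c (\sum_i u i) = \sum_i c (u i).
  pose ca := HB.pack_for {additive A -> 'rV[S]_n.+1} c
    (GRing.isZmodMorphism.Build _ _ c cB).
  exact: (raddf_sum ca).
have c_mulr x a : c (x * a) = \sum_i c x 0 i *: c (b i * a).
  rewrite {1}(cE x) mulr_suml csum; apply: eq_bigr => i _.
  by rewrite -mulrA cZ.
have c_mull x a : c (a * x) = \sum_i c x 0 i *: c (a * b i).
  rewrite {1}(cE x) mulr_sumr csum; apply: eq_bigr => i _.
  by rewrite mulrA -kapC -mulrA cZ.
exists (Coords cB c_inj c_b c_mulr c_mull); split => // r.
by split => [x|x]; [exact: kapC | exact: cZ].
Qed.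
End FreeCoords.

(** * Prime rings and denominators in the centre *)

Lemma ideal_of_Prop (A : pzRingType) (P : A -> Prop) :
    P 0 -> (forall x y, P x -> P y -> P (x - y)) ->
    (forall a x, P x -> P (a * x)) -> (forall a x, P x -> P (x * a)) ->
  exists I : ideal A, forall x, x \in I <-> P x.
Proof.
move=> P0 PB Pl Pr; pose S : {pred A} := fun x => `[< P x >].
have S_zmod : zmod_closed S.
  split=> [|x y /asboolP xS /asboolP yS]; first exact/asboolP.
  exact/asboolP/PB.
have Sl a x : x \in S -> a * x \in S by move/asboolP=> xS; apply/asboolP/Pl.
have Sr a x : x \in S -> x * a \in S by move/asboolP=> xS; apply/asboolP/Pr.
exists (HB.pack_for (ideal A) S (GRing.isZmodClosed.Build A S S_zmod)
                  (isTwoSided.Build A S Sl Sr)) => x.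
by split=> [/asboolP|Px]; last exact/asboolP.
Qed.

Section Prime.
Variable H : nzRingType.
Hypothesis H_prime : prime_ring H.

(** The ideals generated by [z] and of the elements killed by [z] have product
    zero. *)
Lemma central_regular (z x : H) : central z -> z * x = 0 -> z = 0 \/ x = 0.
Proof.
move=> zC zx.
have [|y y' zy zy'|a y zy|a y zy|I II] := @ideal_of_Prop H (fun y => z * y = 0).
- exact: mulr0.
- by rewrite mulrBr zy zy' subrr.
- by rewrite mulrA zC -mulrA zy mulr0.
- by rewrite mulrA zy mul0r.
have [|_ _ [a ->] [b ->]|a _ [b ->]|a _ [b ->]|J JJ] :=
    @ideal_of_Prop H (fun y => exists a, y = z * a).
- by exists 0; rewrite mulr0.
- by exists (a - b); rewrite mulrBr.
- by exists (a * b); rewrite !mulrA zC.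
- by exists (b * a); rewrite mulrA.
have [_ /(_ J I) [|J0|I0]] := H_prime.
- by move=> _ y /JJ[a ->] /II zy; rewrite zC -mulrA zy mulr0.
- by left; apply: J0; apply/JJ; exists 1; rewrite mulr1.
- by right; apply/I0/II.
Qed.

(** The ideal generated by such an [x] has square zero. *)
Lemma prime_semiprime (x : H) : (forall y, x * y * x = 0) -> x = 0.
Proof.
move=> xHx.
have [||||I II] := @ideal_of_Prop H
   (fun y => exists s : seq (H * H), y = \sum_(p <- s) p.1 * x * p.2).
- by exists [::]; rewrite big_nil.
- move=> _ _ [s ->] [t ->]; exists (s ++ [seq (- p.1, p.2) | p <- t]).
  rewrite big_cat big_map -sumrN; congr (_ + _).
  by apply: eq_bigr => p _; rewrite !mulNr.
- move=> a _ [s ->]; exists [seq (a * p.1, p.2) | p <- s].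
  by rewrite big_map mulr_sumr; apply: eq_bigr => p _; rewrite !mulrA.
- move=> a _ [s ->]; exists [seq (p.1, p.2 * a) | p <- s].
  by rewrite big_map mulr_suml; apply: eq_bigr => p _; rewrite !mulrA.
have I0 : {in I, forall x, x = 0}.
  have [|//|//] := proj2 H_prime I I.
  move=> _ _ /II[s ->] /II[t ->]; rewrite mulr_suml; apply: big1 => p _.
  rewrite mulr_sumr; apply: big1 => q _.
  rewrite [LHS](_ : _ = p.1 * (x * (p.2 * q.1) * x) * q.2); last by rewrite !mulrA.
  by rewrite xHx mulr0 mul0r.
by apply: I0; apply/II; exists [:: (1, 1)]; rewrite big_seq1 /= mul1r mulr1.
Qed.

End Prime.

Section FractionCoords.
Variable H : nzRingType.
Hypothesis H_prime : prime_ring H.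
Notation Z := (centre H).
Variables (F : fieldType) (f : {rmorphism Z -> F}).
Hypothesis f_inj : injective f.
Hypothesis f_frac : forall x : F, exists a d, d != 0 /\ f d * x = f a.

Lemma centre_central (z : Z) : central (val z).
Proof. by move=> x; have /asboolP := valP z. Qed.

Lemma centre_of (x : H) : central x -> exists z : Z, x = val z.
Proof. by move=> xC; exists (Centre (introT (asboolP _) xC)). Qed.

Lemma f_eq0 z : (f z == 0) = (z == 0).
Proof. by rewrite -(inj_eq f_inj) rmorph0. Qed.

Lemma centre_mul_eq0 (z : Z) (x : H) : val z * x = 0 -> z != 0 -> x = 0.
Proof.
move=> zx z0; have [vz0|//] := central_regular H_prime (centre_central z) zx.
by move: z0; rewrite -(inj_eq val_inj) vz0 rmorph0 eqxx.
Qed.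

Lemma centre_mul_neq0 (z z' : Z) : z != 0 -> z' != 0 -> z * z' != 0.
Proof. by rewrite -!f_eq0 rmorphM mulf_eq0 => /negPf -> /negPf ->. Qed.

Lemma common_denominator (I : finType) (v : I -> F) :
  exists d, d != 0 /\ exists a, forall i, f d * v i = f (a i).
Proof.
have /choice[a /choice[d ad]] i := f_frac (v i).
exists (\prod_i d i); split.
  by rewrite -f_eq0 rmorph_prod; apply/prodf_neq0 => i _; rewrite f_eq0; case: (ad i).
exists (fun i => \prod_(j | j != i) d j * a i) => i.
rewrite (bigD1 i) //= !rmorphM /=; have [_ <-] := ad i.
by rewrite mulrCA !mulrA.
Qed.

Definition spans_up_to_denominators N (h : 'I_N -> H) : Prop :=
  forall x, exists d : Z, d != 0 /\
    exists c : 'I_N -> Z, val d * x = \sum_i val (c i) * h i.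

(** If a coefficient [c j] of a relation is nonzero, then [c j * h j] is a
    combination of the other members, and [h j] can be dropped. *)
Lemma minimal_spanning_free N (h : 'I_N -> H) :
    spans_up_to_denominators h ->
    (forall M (h' : 'I_M -> H), spans_up_to_denominators h' -> (N <= M)%N) ->
  forall c : 'I_N -> Z, \sum_i val (c i) * h i = 0 -> forall i, c i = 0.
Proof.
case: N h => [h _ _ c _ []//|N h h_span h_min c ch0 j].
apply/eqP; apply: contraT => cj0.
suff /h_min : spans_up_to_denominators (h \o lift j) by rewrite ltnn.
move=> x; have [d [d0 [e def_x]]] := h_span x.
exists (c j * d); split; first exact: centre_mul_neq0.
exists (fun i => c j * e (lift j i) - e j * c (lift j i)).
have sumD (u : 'I_N.+1 -> H) : \sum_i u i = u j + \sum_i u (lift j i).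
  rewrite (bigD1 j) //=; congr (_ + _).
  rewrite (reindex_omap (lift j) (unlift j)) => [|i ji]; last first.
    by case: unliftP ji => [k ->|->]; rewrite ?eqxx.
  by apply: eq_bigl => i; rewrite eq_sym neq_lift liftK eqxx.
under eq_bigr do rewrite rmorphB !rmorphM /= mulrBl -!mulrA.
rewrite sumrB -!mulr_sumr.
have -> : \sum_i val (c (lift j i)) * h (lift j i) = - (val (c j) * h j).
  by apply/eqP; rewrite -addr_eq0 addrC -(sumD (fun i => val (c i) * h i)) ch0.
have := def_x; rewrite sumD => def_x'.
rewrite rmorphM /= -mulrA def_x' mulrDr mulrN opprK addrC; congr (_ + _).
by rewrite !mulrA (centre_central (c j)).
Qed.

(** [H] embedded in its localization at the nonzero central elements, an
    [F]-vector space that need not be constructed: a minimal family spanning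
    up to denominators plays the role of a basis. *)
Lemma fraction_coords :
    (exists N (h : 'I_N -> H), spans_up_to_denominators h) ->
  exists n (C : coords F H n), (forall z, acts_as C (val z) (f z)) /\
    forall v, exists d x, d != 0 /\ C x = f d *: v.
Proof.
move=> ex_h.
pose P N := `[< exists h : 'I_N -> H, spans_up_to_denominators h >].
have exP : exists N, P N by have [N hN] := ex_h; exists N; apply/asboolP.
case: (ex_minnP exP) => N /asboolP[h h_span] N_min.
have h_free : forall c : 'I_N -> Z, \sum_i val (c i) * h i = 0 -> forall i, c i = 0.
  apply: minimal_spanning_free h_span _ => M h' h'_span.
  by apply: N_min; apply/asboolP; exists h'.
case: N => [|n] in h h_span h_free {N_min} *.
  have [d [d0 [c]]] := h_span 1; rewrite big_ord0 => /centre_mul_eq0 /(_ d0).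
  by move=> /eqP; rewrite oner_eq0.
have /choice[d /all_and2[d0 /choice[e de]]] := h_span.
pose c x : 'rV[F]_n.+1 := \row_i (f (e x i) / f (d x)).
have c_uniq x (d1 : Z) (e1 : 'I_n.+1 -> Z) : d1 != 0 ->
    val d1 * x = \sum_i val (e1 i) * h i -> f d1 *: c x = \row_i f (e1 i).
  move=> d10 de1; apply/rowP => i; rewrite !mxE mulrA.
  apply: (canLR (mulfK _)); first by rewrite f_eq0.
  rewrite -!rmorphM; congr (f _); apply/eqP; rewrite -subr_eq0; apply/eqP.
  apply: (h_free (fun i => d1 * e x i - e1 i * d x)) => {i}.
  under eq_bigr do rewrite rmorphB !rmorphM /= mulrBl -!mulrA.
  rewrite sumrB -mulr_sumr -de.
  under [X in _ - X]eq_bigr do rewrite mulrA -centre_central -mulrA.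
  by rewrite -mulr_sumr -de1 !mulrA (centre_central d1) subrr.
(* Every identity between coordinates is checked after clearing denominators. *)
have c_scaled x v (d1 : Z) (e1 : 'I_n.+1 -> Z) : d1 != 0 ->
    val d1 * x = \sum_i val (e1 i) * h i -> f d1 *: v = \row_i f (e1 i) ->
  c x = v.
  move=> d10 /c_uniq-/(_ d10) <- /esym; apply: scalerI.
  by rewrite f_eq0.
have cE x : f (d x) *: c x = \row_i f (e x i) by apply: c_uniq.
have cEi x i : f (d x) * c x 0 i = f (e x i).
  by have /rowP/(_ i) := cE x; rewrite !mxE.
clearbody c.
have cB : zmod_morphism c.
  move=> x y.
  apply: (c_scaled _ _ (d x * d y) (fun i => d y * e x i - d x * e y i)).
  - exact: centre_mul_neq0.
  - under eq_bigr do rewrite rmorphB !rmorphM /= mulrBl -!mulrA.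
    rewrite sumrB -!mulr_sumr -!de rmorphM /= mulrBr -!mulrA; congr (_ - _).
      by rewrite !mulrA (centre_central (d x)).
  - apply/rowP => i; rewrite !mxE !rmorphB !rmorphM /= -!cEi; ring.
have cZ z x : c (val z * x) = f z *: c x.
  apply: (c_scaled _ _ (d x) (fun i => z * e x i)) => //.
    under eq_bigr do rewrite rmorphM /= -mulrA.
    by rewrite -mulr_sumr -de !mulrA (centre_central z).
  by apply/rowP => i; rewrite !mxE rmorphM /= -cEi; ring.
have c_comb (a : 'I_n.+1 -> Z) : c (\sum_i val (a i) * h i) = \row_i f (a i).
  apply: (c_scaled _ _ 1 a); rewrite ?rmorph1 ?mul1r ?scale1r //.
  by rewrite -f_eq0 rmorph1 oner_eq0.
have c_inj : injective c.
  move=> x y cxy; apply/eqP; rewrite -subr_eq0; apply/eqP.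
  apply: (centre_mul_eq0 (z := d (x - y))) (d0 _).
  rewrite de big1 // => i _.
  suff -> : e (x - y) i = 0 by rewrite rmorph0 mul0r.
  by apply/eqP; rewrite -f_eq0 -cEi cB cxy subrr mxE mulr0.
have c_h i : c (h i) = delta_mx 0 i.
  have -> : h i = \sum_j val ((j == i)%:R : Z) * h j.
    rewrite (bigD1 i) //= eqxx rmorph1 mul1r big1 ?addr0 // => j /negPf ->.
    by rewrite rmorph0 mul0r.
  by rewrite c_comb; apply/rowP => j; rewrite !mxE eqxx rmorph_nat.
pose ca := HB.pack_for {additive H -> 'rV[F]_n.+1} c
  (GRing.isZmodMorphism.Build _ _ c cB).
have csum (u : 'I_n.+1 -> H) : c (\sum_i u i) = \sum_i c (u i).
  exact: (raddf_sum ca).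
have c_mulr x a : c (x * a) = \sum_i c x 0 i *: c (h i * a).
  apply: (@scalerI _ _ (f (d x))); first by rewrite f_eq0.
  rewrite -cZ mulrA de mulr_suml csum scaler_sumr; apply: eq_bigr => i _.
  by rewrite -mulrA cZ scalerA cEi.
have c_mull x a : c (a * x) = \sum_i c x 0 i *: c (a * h i).
  apply: (@scalerI _ _ (f (d x))); first by rewrite f_eq0.
  rewrite -cZ mulrA centre_central -mulrA de mulr_sumr csum scaler_sumr.
  apply: eq_bigr => i _.
  by rewrite mulrA -centre_central -mulrA cZ scalerA cEi.
exists n, (Coords cB c_inj c_h c_mulr c_mull); split=> [z|v].
  by split=> [|x]; [exact: centre_central | exact: cZ].
have [d1 [d10 [a ad]]] := common_denominator (fun i => v 0 i).
exists d1, (\sum_i val (a i) * h i); split=> //=.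
by rewrite c_comb; apply/rowP => i; rewrite !mxE ad.
Qed.

End FractionCoords.

(** * The trace form of a prime ring *)

Lemma mulmx_swap_exp (F : comNzRingType) n r
    (U : 'M[F]_(n.+1, r.+1)) (D : 'M_(r.+1, n.+1)) i :
  (U *m D) ^+ i.+1 = U *m (D *m U) ^+ i *m D.
Proof.
elim: i => [|i IHi]; first by rewrite expr1 expr0 mulmx1.
by rewrite exprSr IHi exprSr -!mulmxE !mulmxA.
Qed.

Lemma mxtrace_swap_exp (F : comNzRingType) n r
    (U : 'M[F]_(n.+1, r.+1)) (D : 'M_(r.+1, n.+1)) i :
  \tr ((D *m U) ^+ i.+1) = \tr ((U *m D) ^+ i.+1).
Proof.
rewrite mulmx_swap_exp -mulmxA mxtrace_mulC -mulmxA mulmxE.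
by rewrite -exprSr.
Qed.

Section TraceForm.
Variable H : nzRingType.
Hypothesis H_prime : prime_ring H.
Notation Z := (centre H).
Variables (F : fieldType) (f : {rmorphism Z -> F}).
Hypothesis charF0 : [pchar F] =i pred0.
Hypothesis f_inj : injective f.
Hypothesis f_frac : forall x : F, exists a d, d != 0 /\ f d * x = f a.
Variables (n : nat) (C : coords F H n).
Hypothesis C_acts : forall z, acts_as C (val z) (f z).
Hypothesis C_dense : forall v, exists d x, d != 0 /\ C x = f d *: v.

(** Among the nonzero elements of the radical of the trace form take [x] of
    minimal rank. If [x * y * x] were nonzero it would have the same image as
    [x], so that [x * y] would act invertibly on that image; but all powers of
    [x * y] have trace zero. *)
Lemma trace_form_nondegenerate x : (forall y, \tr (Rm C (x * y)) = 0) -> x = 0.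
Proof.
move=> xJ; apply: contrapT => x0.
pose P r := `[< exists x, [/\ x <> 0, forall y, \tr (Rm C (x * y)) = 0
                           & \rank (Rm C x) = r] >].
have exP : exists r, P r by exists (\rank (Rm C x)); apply/asboolP; exists x.
case: (ex_minnP exP) => r /asboolP[{xJ x0} x [x0 xJ rx]] r_min.
apply: x0; apply: (prime_semiprime H_prime) => y; apply: contrapT => xyx0.
have le_r : (r <= \rank (Rm C (x * y * x)))%N.
  apply/r_min/asboolP; exists (x * y * x); split=> // z.
  by rewrite -!mulrA xJ.
move: (col_base (Rm C x)) (row_base (Rm C x)) (mulmx_base (Rm C x)).
rewrite rx => U D UD; case: r => [|r] in U D UD le_r {rx r_min} *.
  apply: xyx0; apply: (@Rm_inj _ _ _ C); rewrite RmM -UD.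
  by rewrite (flatmx0 D) !mulmx0 raddf0.
(* The matrix of [x * y] on the image of [x]. *)
pose G : 'M[F]_r.+1 := D *m Rm C y *m U.
have : G \notin unitmx.
  apply: mxtrace_pow0_nunit => // i.
  rewrite mxtrace_swap_exp mulmxA UD -RmM -rmorphXn.
  by rewrite exprS -mulrA xJ.
rewrite -row_full_unit /row_full eqn_leq rank_leq_row /= => /negP[].
apply: leq_trans le_r _; rewrite !RmM -UD.
rewrite -!mulmxA (mulmxA D) (mulmxA (D *m _)) mulmxA.
by apply: leq_trans (mxrankM_maxl _ _) _; apply: mxrankM_maxr.
Qed.

Lemma Rm_sum x : Rm C x = \sum_i C x 0 i *: Rm C (cb C i).
Proof.
apply/row_matrixP => j; rewrite rowK co_mull raddf_sum /=.
by apply: eq_bigr => i _; rewrite linearZ /= rowK.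
Qed.

Lemma trace_mulr_sum x y :
  \tr (Rm C (x * y)) = \sum_j C y 0 j * \tr (Rm C (x * cb C j)).
Proof.
rewrite RmM (Rm_sum y) mulmx_sumr raddf_sum; apply: eq_bigr => j _.
by rewrite -scalemxAr /= mxtraceZ -RmM.
Qed.

Lemma trace_RmC x y : \tr (Rm C (x * y)) = \tr (Rm C (y * x)).
Proof. by rewrite !RmM mxtrace_mulC. Qed.

(** The trace form represents the functional by an element [w] up to a
    denominator. As [w] is orthogonal to all commutators, it is central. *)
Lemma functional_killing_commutators (phi : 'cV[F]_n.+1) :
    (forall a b, C (a * b - b * a) *m phi = 0) ->
  exists l, forall x, C x *m phi = (l * \tr (Rm C x))%:M.
Proof.
move=> phiC.
pose G : 'M[F]_n.+1 := \matrix_(i, j) \tr (Rm C (cb C i * cb C j)).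
have CG x : C x *m G = \row_j \tr (Rm C (x * cb C j)).
  apply/rowP => j; rewrite !mxE trace_RmC trace_mulr_sum.
  by apply: eq_bigr => i _; rewrite mxE trace_RmC.
have G_unit : G \in unitmx.
  rewrite unitmxE unitfE; apply/negP => /det0P[v v0 vG].
  have [d [x [d0 Cx]]] := C_dense v.
  suff x0 : x = 0.
    move: Cx; rewrite x0 raddf0 => /esym/eqP.
    by rewrite scaler_eq0 (negPf v0) f_eq0 // (negPf d0).
  apply: trace_form_nondegenerate => y; rewrite trace_mulr_sum big1 // => j _.
  have := CG x; rewrite Cx -scalemxAl vG scaler0 => /rowP/(_ j).
  by rewrite !mxE => <-; rewrite mulr0.
have [d [w [d0 Cw]]] := C_dense (phi^T *m invmx G).
have phi_w x : (f d * (C x *m phi) 0 0) = \tr (Rm C (w * x)).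
  rewrite trace_mulr_sum mxE mulr_sumr; apply: eq_bigr => j _.
  have := CG w; rewrite Cw -scalemxAl mulmxKV // => /rowP/(_ j).
  by rewrite !mxE => <-; rewrite mulrCA.
have fd0 : f d != 0 by rewrite f_eq0.
have wC : central w.
  move=> a; apply/eqP; rewrite -subr_eq0; apply/eqP.
  apply: trace_form_nondegenerate => y.
  rewrite mulrBl raddfB raddfB /= -(mulrA a) (trace_RmC a) -!mulrA.
  by rewrite -!raddfB /= -mulrBr -phi_w phiC mxE mulr0.
have [z wz] := centre_of wC.
exists (f z / f d) => x; apply/rowP => i; rewrite ord1 [RHS]mxE eqxx mulr1n.
apply: (mulfI fd0); rewrite phi_w wz (Rm_acts _ (C_acts z)) mxtraceZ.
by rewrite mulrA mulrCA divff // mulr1.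
Qed.

(** A functional on the coordinates that kills the commutators is a multiple of
    the trace, so it also kills [b]. *)
Lemma trace0_sum_commutators b : \tr (Rm C b) = 0 ->
  exists d : Z, d != 0 /\ exists s : seq (H * H),
    val d * b = \sum_(p <- s) (p.1 * p.2 - p.2 * p.1).
Proof.
move=> trb.
pose comm (p : 'I_n.+1 * 'I_n.+1) := cb C p.1 * cb C p.2 - cb C p.2 * cb C p.1.
pose V := \matrix_(k < #|{: 'I_n.+1 * 'I_n.+1}|) C (comm (enum_val k)).
have commV a c : (C (a * c - c * a) <= V)%MS.
  rewrite raddfB /= (co_mulr C a) (co_mull C a) -sumrB summx_sub // => i _.
  rewrite -scalerBr scalemx_sub // (co_mull C c) (co_mulr C c) -sumrB.
  rewrite summx_sub // => j _; rewrite -scalerBr scalemx_sub //.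
  have -> : C (cb C i * cb C j) - C (cb C j * cb C i) = row (enum_rank (i, j)) V.
    by rewrite rowK enum_rankK -raddfB.
  exact: row_sub.
have bV : (C b <= V)%MS.
  rewrite submxE; apply/eqP/matrixP => i j; rewrite [RHS]mxE ord1 {i}.
  have [|l lP] := functional_killing_commutators (phi := col j (cokermx V)).
    move=> a c; rewrite colE mulmxA.
    by move: (commV a c); rewrite submxE => /eqP ->; rewrite mul0mx.
  have := lP b; rewrite trb mulr0 colE mulmxA -colE => /colP/(_ 0).
  by rewrite !mxE eqxx mul0rn.
have [D CbD] := submxP bV.
have [d [d0 [a ad]]] := common_denominator f_inj f_frac (fun k => D 0 k).
exists d; split=> //.
exists [seq (val (a k) * cb C (enum_val k).1, cb C (enum_val k).2) | k <- enum 'I__].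
rewrite big_map big_enum /=; apply: (@co_inj _ _ _ C).
have [_ ->] := C_acts d; rewrite CbD mulmx_sum_row scaler_sumr raddf_sum.
apply: eq_bigr => k _; rewrite scalerA ad rowK /=.
have [_ <-] := C_acts (a k); congr (C _).
by rewrite mulrBr !mulrA (centre_central (a k) (cb C (enum_val k).2)).
Qed.

End TraceForm.

(** * Free prime algebras with integrally closed centre *)

(** The field is carried by [A] itself; an isomorphic copy is enough for the
    uses below and hides its construction. *)
Lemma field_of_inverses (A : comPzRingType) : 1 != 0 :> A ->
    (forall x : A, x != 0 -> exists y, y * x = 1) ->
  exists (F : fieldType) (f : {rmorphism A -> F}) (g : F -> A), cancel f g /\ cancel g f.
Proof.
move=> A10 A_inv.
have /choice[inv invP] (x : A) : exists y, (x != 0 -> y * x = 1) /\ (x = 0 -> y = 0).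
  have [->|x0] := eqVneq x 0; first by exists 0.
  by have [y yx] := A_inv x x0; exists y; split=> // /eqP; rewrite (negPf x0).
pose A1 : comNzRingType := HB.pack_for comNzRingType (GRing.ComPzRing.sort A)
  (GRing.ComPzRing.class A) (GRing.PzSemiRing_isNonZero.Build A A10).
have mulVx : forall x : A1, x != 0 -> inv x * x = 1 by move=> x; case: (invP x).
have inv0 : inv (0 : A1) = 0 by case: (invP 0) => _; apply.
pose F : fieldType := HB.pack_for fieldType (GRing.ComPzRing.sort A)
  (GRing.ComNzRing.class A1)
  (GRing.ComNzRing_isField.Build A1 mulVx inv0).
by exists F, idfun, id.
Qed.

(** Integral closedness is kept in the form of the equation satisfied by [x]. *)
Lemma fraction_field (Z : comPzRingType) : integrally_closed_domain Z ->
  exists (F : fieldType) (f : {rmorphism Z -> F}),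
   [/\ injective f, forall x : F, exists a d, d != 0 /\ f d * x = f a
     & forall (x : F) n (c : 'I_n -> Z), x ^+ n + \sum_(i < n) f (c i) * x ^+ i = 0 ->
       exists a, x = f a].
Proof.
move=> [P P0 Z_closed].
have PE x : (x \in prime_compl P) = (x != 0) by rewrite unfold_in P0.
pose f := loc_map (prime_compl P).
have f_inj : injective f.
  move=> x y /mkfracP[u]; rewrite PE /= !mulr1 => u0 uxy.
  apply/eqP; rewrite -subr_eq0; have /prime_mul : u * (x - y) \in P by rewrite P0 inE uxy.
  by rewrite !P0 !inE (negPf u0).
have mk_eq (x y : Defs.frac (prime_compl P)) :
    x.1 * val y.2 = y.1 * val x.2 -> mkfrac x = mkfrac y.
  by move=> e; apply/mkfracP; exists 1; rewrite ?rpred1 // e subrr mulr0.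
have fB : zmod_morphism f.
  move=> x y; rewrite /f /loc_map.
  rewrite -[X in _ = _ - X]/(mkfrac _) -[RHS]/(loc_add _ (loc_opp _)) mkfracN mkfracD.
  by apply: mk_eq; rewrite /= !mulr1.
have fM : monoid_morphism f.
  split=> // x y; rewrite -[RHS]/(loc_mul _ _) mkfracM.
  by apply: mk_eq; rewrite /= !mulr1.
pose g := HB.pack_for {rmorphism Z -> loc_prime P} f
  (GRing.isZmodMorphism.Build _ _ f fB) (GRing.isMonoidMorphism.Build _ _ f fM).
have g_frac x : exists a d, d != 0 /\ g d * x = g a.
  have [[a [d dP]] ->] := locP x; exists a, d; split; first by rewrite -PE.
  rewrite -[LHS]/(loc_mul _ _) mkfracM; apply: mk_eq => /=.
  by rewrite !mulr1 mul1r mulrC.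
have [||F [h [h' [hK h'K]]]] := @field_of_inverses (loc_prime P).
- rewrite -(rmorph1 g) -(rmorph0 g) (inj_eq f_inj) -PE; exact: rpred1.
- move=> x x0; have [[a [d dP]] def_x] := locP x.
  have aP : a \in prime_compl P.
    rewrite PE; apply: contra_neq x0 => a0; rewrite def_x a0.
    by apply: mk_eq; rewrite /= !mul0r.
  exists (mkfrac (val (Den dP), Den aP)).
  rewrite def_x -[LHS]/(loc_mul _ _) mkfracM; apply: mk_eq => /=.
  by rewrite mulr1 mul1r mulrC.
exists F, (h \o g); split.
- by move=> x y /(can_inj hK)/f_inj.
- move=> x; have [a [d [d0 dx]]] := g_frac (h' x); exists a, d; split=> //.
  by rewrite -[RHS]/(h (g a)) -dx rmorphM h'K.
- move=> x n c xn; have [|a ax] := Z_closed (h' x).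
    exists n, c; apply: (can_inj hK); rewrite rmorph0 -[RHS]xn.
    rewrite rmorphD rmorphXn h'K rmorph_sum; congr (_ + _).
    by apply: eq_bigr => i _; rewrite rmorphM rmorphXn h'K.
  by exists a; rewrite -[RHS]/(h (loc_map _ a)) -ax h'K.
Qed.

Lemma Rm_horner (S F : comNzRingType) (A : nzRingType) (kap : {rmorphism S -> A})
    (g : {rmorphism S -> F}) n (C : coords F A n) (a : A) (p : {poly S}) :
    (forall s, acts_as C (kap s) (g s)) ->
  Rm C (map_poly kap p).[a] = horner_mx (Rm C a) (map_poly g p).
Proof.
move=> kap_acts; elim/poly_ind: p => [|p c IHp]; first by rewrite !rmorph0 horner0 raddf0.
rewrite !rmorphD !rmorphM /= !map_polyX !map_polyC /= hornerMXaddC.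
by rewrite raddfD /= RmM IHp (Rm_scalar (kap_acts c)) horner_mx_X horner_mx_C.
Qed.

Lemma central_rmorphism (R : comNzRingType) (H : nzRingType)
    (iota : {rmorphism R -> H}) : central_map iota ->
  exists j : {rmorphism R -> centre H}, forall r, val (j r) = iota r.
Proof.
move=> iotaC.
have iota_in r : iota r \in @centre_pred H by apply/asboolP/iotaC.
pose j r := Centre (iota_in r).
have jB : zmod_morphism j by move=> x y; apply/val_inj; rewrite /= rmorphB.
have jM : monoid_morphism j.
  by split=> [|x y]; apply/val_inj; rewrite /= ?rmorph1 ?rmorphM.
exists (HB.pack_for {rmorphism R -> centre H} j
  (GRing.isZmodMorphism.Build _ _ j jB) (GRing.isMonoidMorphism.Build _ _ j jM)).
by [].
Qed.

Section FreePrime.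
Variables (R : comNzRingType) (H : nzRingType) (iota : {rmorphism R -> H}).
Hypothesis iota_inj : injective iota.
Hypothesis iotaC : central_map iota.
Hypothesis H_prime : prime_ring H.
Hypothesis Z_int_closed : integrally_closed_domain (centre H).
Hypothesis H_char0 : forall k, k.+1%:R != 0 :> H.
Variables (n : nat) (C : coords R H n).
Hypothesis C_acts : forall r, acts_as C (iota r) r.
Hypothesis C_basis : forall x, x = \sum_i iota (C x 0 i) * cb C i.

Lemma annihilating_polynomial (x : H) :
  exists p : {poly R}, p \is monic /\ (map_poly iota p).[x] = 0.
Proof.
exists (char_poly (Rm C x)); split; first exact: char_poly_monic.
apply: (@Rm_inj _ _ _ C); rewrite (Rm_horner (g := idfun)) // map_poly_id //.
by rewrite Cayley_Hamilton raddf0.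
Qed.

(** In an annihilating polynomial of [d] one may assume a nonzero constant term,
    [d] being regular. *)
Lemma central_divides_scalar (d : H) : central d -> d != 0 ->
  exists c e, c != 0 /\ iota c = e * d.
Proof.
move=> dC d0; have [p [/monic_neq0 + pd0]] := annihilating_polynomial d.
elim/poly_ind: p pd0 => [|p c IHp]; first by rewrite eqxx.
rewrite rmorphD rmorphM /= map_polyX map_polyC /= hornerMXaddC => pd0.
have [c0 p0|c0 _] := eqVneq c 0; last first.
  exists c, (- (map_poly iota p).[d]); split=> //.
  by apply/eqP; rewrite mulNr -addr_eq0 addrC pd0.
move: pd0; rewrite c0 rmorph0 addr0 -dC => /(central_regular H_prime dC)[/eqP|].
  by rewrite (negPf d0).
move=> /IHp; apply; apply: contraNneq p0 => ->.
by rewrite c0 mul0r add0r.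
Qed.

(** For [N.+1] the dimension of [H] over its centre and [t] the trace of [b] over the
    fraction field of the centre, [b *+ N.+1 - t] has trace zero, so a central
    multiple of it is a sum of commutators, on which [bitrace] vanishes. *)
Lemma bitrace_central_part :
  exists N, forall b, exists t, central t /\
    forall a, bitrace C a b *+ N.+1 = bitrace C a t.
Proof.
have [F [f [f_inj f_frac f_closed]]] := fraction_field Z_int_closed.
have [j jE] := central_rmorphism iotaC.
have charF0 : [pchar F] =i pred0.
  apply/pcharf0P => -[|k]; first by rewrite mulr0n !eqxx.
  rewrite -(rmorph_nat f) f_eq0 // -(inj_eq val_inj) rmorph_nat rmorph0.
  by rewrite (negPf (H_char0 k)).
have [|N [D [D_acts D_dense]]] := fraction_coords H_prime f_inj f_frac.
  exists n.+1, (cb C) => x; exists 1; split.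
    by rewrite -(f_eq0 f_inj) rmorph1 oner_eq0.
  exists (fun i => j (C x 0 i)); rewrite rmorph1 mul1r {1}(C_basis x).
  by apply: eq_bigr => i _; rewrite jE.
exists N => b.
have [t tE] : exists t, \tr (Rm D b) = f t.
  have [p [p_mon pb0]] := annihilating_polynomial b.
  have : integralOver (f \o j) (\tr (Rm D b)).
    apply: mxtrace_integral p_mon _.
    rewrite -(Rm_horner (kap := iota)) ?pb0 ?raddf0 // => r.
    by rewrite -jE; apply: D_acts.
  case=> q q_mon /rootP; rewrite horner_coef => q0.
  apply: (f_closed _ (size q).-1 (fun i => j q`_i)); move: q0.
  rewrite size_map_poly_id0; last first.
    by rewrite (monicP q_mon) rmorph1 oner_eq0.
  rewrite (polySpred (monic_neq0 q_mon)) big_ord_recr /= addrC coef_map /=.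
  move: (monicP q_mon); rewrite lead_coefE => ->; rewrite !rmorph1 mul1r => q0.
  rewrite -[RHS]q0; congr (_ + _).
  by apply: eq_bigr => i _; rewrite coef_map.
exists (val t); split; first exact: centre_central.
move=> a; apply/eqP; rewrite -bitraceMnr -subr_eq0 -bitraceBr; apply/eqP.
set b1 := _ - _.
have trb1 : \tr (Rm D b1) = 0.
  rewrite !raddfB raddfMn /= raddfMn /= tE.
  by rewrite (Rm_scalar (D_acts t)) mxtrace_scalar subrr.
have [d [d0 [s ds]]] :=
  trace0_sum_commutators H_prime charF0 f_inj f_frac D_acts D_dense trb1.
have db1 x : bitrace C x (val d * b1) = 0.
  by rewrite ds bitrace_sumr big1 // => p _; rewrite bitraceBr bitraceC subrr.
have [||c [e [c0 ced]]] := @central_divides_scalar (val d).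
- exact: centre_central.
- by apply: contra_neq d0 => vd0; apply: val_inj; rewrite vd0 rmorph0.
have : c * bitrace C a b1 = 0.
  rewrite -(bitraceZl _ _ (C_acts c)) ced -mulrA mulrA -centre_central -mulrA.
  by rewrite bitrace_central ?db1 //; apply: centre_central.
move=> /(congr1 iota); rewrite rmorphM rmorph0.
case/(central_regular H_prime (iotaC c)) => /eqP.
  by rewrite -(rmorph0 iota) (inj_eq iota_inj) (negPf c0).
by rewrite -{1}(rmorph0 iota) (inj_eq iota_inj) => /eqP.
Qed.

End FreePrime.

(** * Blocks of a finite-dimensional algebra *)

(** The [q]-primary part of [p]. *)
Lemma irreducible_split_off (F : fieldType) (q p : {poly F}) :
    irreducible_poly q -> p != 0 ->
  exists e g, p = q ^+ e * g /\ coprimep q g.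
Proof.
move=> q_irr; have [n] := ubnP (size p); elim: n p => // n IHn p lepn p0.
have [/dvdpP[r def_p]|qNp] := boolP (q %| p); last first.
  by exists 0, p; rewrite expr0 mul1r irreducible_poly_coprime.
have q_gt1 := q_irr.1.
have [r0 q0] : r != 0 /\ q != 0.
  by split; apply: contraNneq p0 => z0; rewrite def_p z0 ?mul0r ?mulr0.
have [||e [g [def_r cop]]] := IHn r.
- move: lepn; rewrite def_p size_mul //; move: q_gt1 r0; rewrite -size_poly_gt0.
  by case: (size q) (size r) => [|[|a]] // [|b] //=; lia.
- by [].
by exists e.+1, g; split=> //; rewrite def_p def_r exprSr mulrAC.
Qed.

Section Block.
Variables (k : fieldType) (A : nzRingType) (kap : {rmorphism k -> A}).
Hypothesis k_char0 : [pchar k] =i pred0.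
Variables (n : nat) (C : coords k A n).
Hypothesis kap_acts : forall c, acts_as C (kap c) c.
Variables (I : ideal A) (c : A).
Hypothesis cI : c \in I.
Hypothesis c_mull : {in I, forall x, c * x = x}.
Hypothesis c_mulr : {in I, forall x, x * c = x}.
Hypothesis I_indec : indecomposable_ideal I.

Local Notation tr x := (\tr (Rm C x)).
Local Notation ev p u := (map_poly kap p).[u].

Lemma kapC r : central (kap r). Proof. by case: (kap_acts r). Qed.

Lemma block_unit_central : central c.
Proof.
move=> x; have cx := Defs.idealMr x cI; have xc := Defs.idealMl x cI.
by rewrite -(c_mulr cx) -mulrA c_mull.
Qed.

Lemma block_unit_neq0 : c != 0.
Proof.
have [[x xI x0] _] := I_indec.
by apply: contraNneq x0 => c0; rewrite -(c_mull xI) c0 mul0r.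
Qed.

Lemma centralM (x y : A) : central x -> central y -> central (x * y).
Proof. by move=> xC yC z; rewrite -mulrA yC !mulrA xC. Qed.

Lemma centralB (x y : A) : central x -> central y -> central (x - y).
Proof. by move=> xC yC z; rewrite mulrBl mulrBr xC yC. Qed.

Lemma Rm_ev p u : Rm C (ev p u) = horner_mx (Rm C u) p.
Proof. by rewrite (Rm_horner (g := idfun)) // map_poly_id. Qed.

Lemma evM p q u : ev (p * q) u = ev p u * ev q u.
Proof. by apply: (@Rm_inj _ _ _ C); rewrite RmM !Rm_ev rmorphM. Qed.

Lemma evD p q u : ev (p + q) u = ev p u + ev q u.
Proof. by rewrite rmorphD hornerD. Qed.

Lemma ev1 u : ev 1 u = 1.
Proof. by rewrite rmorph1 hornerC. Qed.

Lemma evC r u : ev r%:P u = kap r.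
Proof. by rewrite map_polyC hornerC. Qed.

Lemma evX u : ev 'X u = u.
Proof. by rewrite map_polyX hornerX. Qed.

Lemma ev_central p u : central u -> central (ev p u).
Proof.
move=> uC; elim/poly_ind: p => [|p r IHp] x; first by rewrite rmorph0 horner0 mul0r mulr0.
by rewrite evD evM evX evC mulrDl mulrDr -mulrA uC !mulrA IHp kapC.
Qed.

(** [E1] and [E2] split the block into the two ideals that they annihilate. *)
Lemma indecomposable_idempotents E1 E2 :
    central E1 -> central E2 -> E1 + E2 = c -> E1 * E2 = 0 ->
  E1 * c = 0 \/ E2 * c = 0.
Proof.
move=> E1C E2C E12 E1E2.
have ann_ideal E : central E ->
    exists J : ideal A, forall x, x \in J <-> x \in I /\ E * x = 0.
  move=> EC; apply: ideal_of_Prop => [|x y [xI Ex] [yI Ey]|a x [xI Ex]|a x [xI Ex]].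
  - by rewrite rpred0 mulr0.
  - by rewrite rpredB // mulrBr Ex Ey subrr.
  - by rewrite Defs.idealMl // mulrA EC -mulrA Ex mulr0.
  - by rewrite Defs.idealMr // mulrA Ex mul0r.
have [J1 J1P] := ann_ideal _ E2C; have [J2 J2P] := ann_ideal _ E1C.
have dec x : x \in I -> x = E1 * x + E2 * x.
  by move=> xI; rewrite -mulrDl E12 c_mull.
have J1_mem x : x \in I -> E1 * x \in J1.
  by move=> xI; apply/J1P; rewrite Defs.idealMl // mulrA -E1C E1E2 mul0r.
have J2_mem x : x \in I -> E2 * x \in J2.
  by move=> xI; apply/J2P; rewrite Defs.idealMl // mulrA E1E2 mul0r.
have [||x xI|x /J1P[xI x1] /J2P[_ x2]|J10|J20] := I_indec.2 J1 J2.
- by move=> x /J1P[].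
- by move=> x /J2P[].
- by exists (E1 * x), (E2 * x); split; [exact: J1_mem | exact: J2_mem | exact: dec].
- by rewrite (dec x xI) x1 x2 addr0.
- by left; apply/J10/J1_mem.
- by right; apply/J20/J2_mem.
Qed.

(** Bezout idempotents separate coprime factors of an annihilating polynomial,
    and a block has no nontrivial central idempotent. *)
Lemma central_primary u : central u ->
  exists q e, [/\ q \is monic, irreducible_poly q & ev (q ^+ e) u * c = 0].
Proof.
move=> uC.
have : ev (char_poly (Rm C u)) u * c = 0.
  have -> : ev (char_poly (Rm C u)) u = 0.
    by apply: (@Rm_inj _ _ _ C); rewrite Rm_ev Cayley_Hamilton raddf0.
  by rewrite mul0r.
move: (char_poly _) (monic_neq0 (char_poly_monic (Rm C u))) => p.
have [m] := ubnP (size p); elim: m p => // m IHm p lepm p0 puc.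
have [p1|p_gt1] := leqP (size p) 1.
  move: puc p0; rewrite (size1_polyC p1) evC polyC_eq0 => pc p0.
  have: kap ((p`_0)^-1) * (kap p`_0 * c) = 0 by rewrite pc mulr0.
  rewrite mulrA -rmorphM mulVf // rmorph1 mul1r => /eqP.
  by rewrite (negPf block_unit_neq0).
have [q q_irr qp] := irreducible_factor p_gt1.
wlog q_mon : q q_irr qp / q \is monic.
  move=> wlog_q; have lq0 : lead_coef q != 0.
    by rewrite lead_coef_eq0 -size_poly_gt0 ltnW // q_irr.1.
  have eq_q : (lead_coef q)^-1 *: q %= q by rewrite eqp_scale ?invr_eq0.
  apply: (wlog_q ((lead_coef q)^-1 *: q)); rewrite ?(eqp_dvdl _ eq_q) //.
    split=> [|r r1]; first by rewrite size_scale ?invr_eq0 // q_irr.1.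
    rewrite (eqp_dvdr _ eq_q) => /q_irr.2-/(_ r1) /eqp_trans; apply.
    by rewrite eqp_sym.
  by rewrite monicE lead_coefZ mulVf.
have [e [g [def_p cop]]] := irreducible_split_off q_irr p0.
have : coprimep (q ^+ e) g by apply: coprimep_expl.
case/Bezout_eq1_coprimepP => -[al be] /= bez.
pose E1 := ev (al * q ^+ e) u * c; pose E2 := ev (be * g) u * c.
have cC := block_unit_central; have cc : c * c = c by apply: c_mull.
have [||||E10|E20] := @indecomposable_idempotents E1 E2.
- exact/centralM/cC/ev_central.
- exact/centralM/cC/ev_central.
- by rewrite -mulrDl -evD bez ev1 mul1r.
- have -> : E1 * E2 = ev (al * q ^+ e * (be * g)) u * c.
    rewrite [in RHS]evM /E1 /E2 -!mulrA (mulrA c).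
    by rewrite (cC (map_poly kap (be * g)).[u]) -mulrA cc.
  have -> : al * q ^+ e * (be * g) = al * be * p by rewrite def_p; ring.
  by rewrite evM -mulrA puc mulr0.
- exists q, e; split=> //.
  have : ev (q ^+ e) u * (ev (be * g) u * c) = 0.
    rewrite mulrA -evM mulrCA -def_p evM.
    by rewrite -mulrA puc mulr0.
  have -> : ev (be * g) u * c = c; last by [].
    rewrite -[RHS]mul1r -(ev1 u) -bez evD mulrDl.
    by move: E10; rewrite /E1 -mulrA cc => ->; rewrite add0r.
have gc0 : ev g u * c = 0.
  have -> : c = ev (al * q ^+ e) u * c.
    rewrite -[LHS]mul1r -(ev1 u) -bez evD mulrDl.
    by move: E20; rewrite /E2 -mulrA cc => ->; rewrite addr0.
  rewrite mulrA -evM (_ : g * _ = al * p); last by rewrite def_p; ring.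
  by rewrite evM -mulrA puc mulr0.
have [g0 e0] : g != 0 /\ e != 0%N.
  split; first by apply: contraNneq p0 => g0; rewrite def_p g0 mulr0.
  move: cop; apply: contraTneq => e0.
  rewrite irreducible_poly_coprime // negbK.
  by rewrite -[g]mul1r -(expr0 q) -e0 -def_p.
have lt_gp : (size g < size p)%N.
  rewrite def_p size_mul ?expf_neq0 ?(monic_neq0 q_mon) //.
  have : (1 < size (q ^+ e))%N.
    move: (size_exp q e) q_irr.1 e0; case: (size q) => [|[|a]] //=.
    by case: (size _) => [|[|b]] //= /esym/eqP; rewrite muln_eq0 /= => /eqP ->.
  by case: (size (q ^+ e)) => [|[|b]] // _; rewrite addSn -[X in (X <= _)%N]add1n leq_add2r.
exact: (IHm g (leq_trans lt_gp lepm) g0 gc0).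
Qed.


Let natr_eq0k := proj1 (@pcharf0P k) k_char0.

(** By [mxtrace_primary_idem] the average eigenvalue of a central [u] is the same
    on the image of every idempotent of the block. *)
Lemma trace_central_idem u e : u \in I -> central u -> e \in I -> e * e = e ->
  tr c * tr (u * e) = tr e * tr u.
Proof.
move=> uI uC eI ee; have [q [s [q_mon q_irr qc]]] := central_primary uC.
have avg x : x \in I -> x * x = x ->
    tr (u * x) *+ (size q).-1 = - subcoef q * tr x.
  move=> xI xx; rewrite RmM; apply: (mxtrace_primary_idem (e := s)) => //.
  - by rewrite -RmM xx.
  - by rewrite -!RmM uC.
  - by rewrite -Rm_ev -RmM -(c_mull xI) mulrA qc mul0r raddf0.
have deg_q : (size q).-1%:R != 0 :> k.
  rewrite natr_eq0k //.
  by move: q_irr.1; case: (size q) => [|[|]].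
apply: (mulIf deg_q); rewrite -!mulrA !mulr_natr -{2}(c_mulr uI).
by rewrite !avg // ?c_mull //; ring.
Qed.

Lemma trace_idem_eq0 e : e * e = e -> (tr e == 0) = (e == 0).
Proof.
move=> ee; rewrite mxtrace_idem -?RmM ?ee // natr_eq0k // mxrank_eq0.
by rewrite -[in RHS](inj_eq (@Rm_inj _ _ _ C)) raddf0.
Qed.

Variable N : nat.
Hypothesis central_part : forall b, exists t, central t /\
  forall a, bitrace C a b *+ N.+1 = bitrace C a t.

(** The central element [z] of the block with [bitrace a e *+ N.+1 = bitrace a z] is a
    rational number modulo nilpotents: correcting it by the scalar that makes
    its trace vanish gives [y] with [tr (u * y) = 0] for all central [u]. Then
    the irreducible polynomial attached to [y] has constant term zero. *)
Lemma bitrace_idem e a : e \in I -> e * e = e ->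
  tr c * bitrace C a e = tr e * bitrace C a c.
Proof.
move=> eI ee; have cC := block_unit_central.
have cc : c * c = c by apply: c_mull.
have [t [tC tE]] := central_part e.
pose z := c * t; have zC : central z by apply: centralM.
have zE x : bitrace C x z = bitrace C x e *+ N.+1.
  by rewrite -(bitrace_central _ _ _ cC) -tE bitrace_central // c_mull.
pose y := kap (tr c) * z - kap (tr e *+ N.+1) * c.
have yC : central y by apply: centralB; apply/centralM => //; apply: kapC.
have yI : y \in I.
  by rewrite rpredB // Defs.idealMl // Defs.idealMr.
have byE x : bitrace C x y = tr c * bitrace C x z - tr e *+ N.+1 * bitrace C x c.
  by rewrite bitraceBr !(bitraceZr _ _ (kap_acts _)).
have tr_uy u : u \in I -> central u -> tr (u * y) = 0.
  move=> uI uC; rewrite -bitrace1 -bitrace_central // mulr1 byE zE.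
  have bu x : bitrace C u x = tr (u * x) by rewrite -bitrace1 -bitrace_central // mulr1.
  rewrite !bu (c_mulr uI) mulrnAr (trace_central_idem uI uC eI ee).
  by rewrite mulrnAl subrr.
have [q [s [q_mon q_irr qc]]] := central_primary yC.
have trc0 : tr c != 0 by rewrite trace_idem_eq0 ?block_unit_neq0.
have [p [r def_q]] : exists p r, q ^+ s = p * 'X + r%:P.
  elim/poly_ind: (q ^+ s) => [|p r _]; last by exists p, r.
  by exists 0, 0; rewrite mul0r add0r.
have r0 : r = 0.
  apply/eqP; have := congr1 (fun x => tr x) qc.
  rewrite def_q evD evM evX evC mulrDl raddfD raddfD /=.
  have -> : ev p y * y * c = ev p y * c * y by rewrite -mulrA -cC mulrA.
  rewrite tr_uy ?add0r; last 2 first.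
  - exact: Defs.idealMl.
  - exact/centralM/cC/ev_central.
  rewrite (Rm_acts _ (kap_acts r)) mxtraceZ !raddf0 => /eqP.
  by rewrite mulf_eq0 (negPf trc0) orbF.
have q_X : q = 'X.
  have : root (q ^+ s) 0 by rewrite def_q r0 addr0 rootM rootX eqxx orbT.
  rewrite /root horner_exp expf_eq0 => /andP[_].
  rewrite -[_ == 0]/(root q 0) -dvdp_XsubCl subr0 => Xq.
  apply/eqP; rewrite eq_sym -eqp_monic ?monicX //.
  by apply: q_irr.2 Xq; rewrite size_polyX.
have y_nil : y ^+ s.+1 = 0.
  move: qc; rewrite q_X map_polyXn hornerXn => ysc.
  by rewrite exprSr -[X in _ * X](c_mull yI) mulrA ysc mul0r.
have : bitrace C a y = 0.
  apply: (mxtrace_nilpotent (e := s.+1)).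
  rewrite mulmxE exprMn_comm; last by rewrite /GRing.comm -mulmxE Lm_Rm.
  by rewrite -(rmorphXn (Rm C)) y_nil raddf0 mulr0.
rewrite byE zE mulrnAr mulrnAl -mulrnBl => /eqP.
rewrite -mulr_natr mulf_eq0 natr_eq0k orbF subr_eq0 => /eqP //.
Qed.

End Block.

(** * Projective covers of simple modules *)

Section ModuleTools.
Variable B : pzRingType.

Lemma submod_of_Prop (M : lmodType B) (P : M -> Prop) :
    P 0 -> (forall a x y, P x -> P y -> P (a *: x + y)) ->
  exists N : submodClosed M, forall x, x \in N <-> P x.
Proof.
move=> P0 PD; pose S : {pred M} := fun x => `[< P x >].
have S_closed : submod_closed S.
  split=> [|a x y /asboolP xS /asboolP yS]; first exact/asboolP.
  exact/asboolP/PD.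
exists (HB.pack_for (submodClosed M) S
  (GRing.isSubmodClosed.Build B M S S_closed)) => x.
by split=> [/asboolP|Px]; last exact/asboolP.
Qed.

Lemma linear_of (M N : lmodType B) (f : M -> N) :
  (forall a x y, f (a *: x + y) = a *: f x + f y) ->
  exists g : {linear M -> N}, forall x, g x = f x.
Proof.
move=> fP; have f_lin : linear f by move=> a x y; apply: fP.
by exists (HB.pack_for {linear M -> N} f (GRing.isLinear.Build B M N *:%R f f_lin)).
Qed.

(** The elements of a simple module share every linear property of one nonzero
    element; most uses say that a nonzero element generates. *)
Lemma simple_sub (L : lmodType B) (P : L -> Prop) : simple_module L ->
    (forall a x y, P x -> P y -> P (a *: x + y)) ->
    (exists2 x, P x & x != 0) ->
  forall x, P x.
Proof.
move=> [_ L_simple] PD [x0 Px0 x00] x.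
have P0 : P 0 by rewrite -(addNr x0) -scaleN1r; apply: PD.
have [N NP] := submod_of_Prop P0 PD; apply/NP.
have [N0|-> //] := L_simple N.
by move: x00; rewrite -[_ == 0]/(x0 \in pred1 0) -N0; move/NP: Px0 => ->.
Qed.

Lemma inj_surj_bij (X Y : Type) (f : X -> Y) :
  injective f -> (forall y, exists x, f x = y) -> bijective f.
Proof.
move=> f_inj /choice[g gK]; exists g => // x.
by apply: f_inj; rewrite gK.
Qed.

Lemma lmod_quot_projection (M : lmodType B) (N : submodClosed M) :
  exists pi : {linear M -> lmod_quot N},
    (forall y, exists x, pi x = y) /\ (forall x, pi x = 0 <-> x \in N).
Proof.
have [|pi piE] := @linear_of M (lmod_quot N) (lmod_proj N).
  by move=> a x y; rewrite -lmod_projD -lmod_projZ.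
exists pi; split=> [y|x].
  by have [x ->] := lmod_quotP y; exists x.
have <- : pi 0 = 0 by apply: raddf0.
rewrite !piE; have := Quotient.idealrBE (submod_zmod N) x 0.
rewrite subr0 => xN; split=> [/eqP e|xI]; first by rewrite [_ \in _]xN.
by apply/eqP; rewrite -[_ == _]xN.
Qed.

(** The quotient by a left ideal that is maximal among those without [1]. The
    empty set is allowed in the application of the lemma of Zorn, so that the
    union of the empty chain is no exception. *)
Lemma simple_module_exists : 1 != 0 :> B -> exists L : lmodType B, simple_module L.
Proof.
move=> B10.
pose P (A : set B) := ~ A 1 /\ forall a x y, A x -> A y -> A (a * x + y).
have [|A [[A1 AD] A_max]] := @Zorn_bigcup B P.
  move=> F FP F_tot; split=> [[X /FP[X1 _]] //|a x y [X FX Xx] [Y FY Yy]].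
  have [XY|YX] := F_tot _ _ FX FY.
    by exists Y => //; apply: (FP _ FY).2 => //; apply: XY.
  by exists X => //; apply: (FP _ FX).2 => //; apply: YX.
have A0 : A 0.
  apply: contrapT => A0.
  have A_empty x : ~ A x.
    by move=> Ax; apply: A0; rewrite -(addNr x) -mulN1r; apply: AD.
  apply: (A_max (fun x => x = 0)).
    by split=> [x /A_empty //|/(_ 0) H0]; apply: (@A_empty 0); apply: H0.
  split=> [/eqP|a x y -> ->]; first by rewrite (negPf B10).
  by rewrite mulr0 addr0.
have [N NP] := @submod_of_Prop B^o A A0 AD.
have [pi [pi_onto pi0]] := lmod_quot_projection N.
have pi1 : pi 1 != 0 by apply/eqP => /pi0/NP.
exists (lmod_quot N); split; first by exists (pi 1).
move=> N'.
have [N1|N1] := boolP (pi 1 \in N'); [right|left] => y; have [x <-] := pi_onto y.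
  by rewrite -[x]mulr1 [pi _]linearZ rpredZ.
rewrite inE; apply/idP/eqP => [xN'|->]; last exact: rpred0.
apply/pi0/NP; apply: contrapT => Ax.
apply: (A_max (fun x => pi x \in N')).
  split=> [a /NP/pi0 ->|/(_ x xN') //]; exact: rpred0.
split=> [|a u v uN vN]; first exact/negP.
by rewrite [pi _]linearD [pi (a * u)]linearZ rpredD // rpredZ.
Qed.

(** A projective cover of a simple module is generated by a preimage [x1] of a
    nonzero element, and lifting the identity along [b |-> b *: x1] realizes it as
    the left ideal generated by an idempotent. *)
Lemma projective_cover_idempotent (P L : lmodType B) (p : {linear P -> L}) :
    simple_module L -> projective_cover p ->
  exists (e : B) (g : {linear P -> B^o}),
    [/\ e * e = e, injective g & forall x : B, (exists y, g y = x) <-> x * e = x] /\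
    (exists2 x : L, x != 0 & e *: x = x) /\
    forall X : lmodType B, simple_module X ->
      (exists x : X, e *: x != 0) -> lmod_isom X L.
Proof.
move=> L_simple [P_proj p_onto p_small].
have [[l0 l00] _] := L_simple; have [x1 px1] := p_onto l0.
have L_gen l : exists b, l = b *: l0.
  move: l; apply: (simple_sub (P := fun l => exists b, l = b *: l0) L_simple).
    by move=> a _ _ [b ->] [b' ->]; exists (a * b + b'); rewrite scalerDl scalerA.
  by exists l0 => //; exists 1; rewrite scale1r.
have P_gen x : exists b, b *: x1 = x.
  have [||N NP] := @submod_of_Prop P (fun x => exists b, b *: x1 = x).
  - by exists 0; rewrite scale0r.
  - by move=> a _ _ [b <-] [b' <-]; exists (a * b + b'); rewrite scalerDl scalerA.
  apply/NP; rewrite (p_small N) // => y.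
  have [b pyb] := L_gen (p y); exists (b *: x1); first by apply/NP; exists b.
  by rewrite raddfB /= linearZ /= px1 pyb subrr.
have [|q qE] := @linear_of B^o P (fun b => b *: x1).
  by move=> a x y; rewrite scalerDl scalerA.
have [|g gK] := P_proj B^o P q idfun.
  by move=> y; have [b <-] := P_gen y; exists b; rewrite qE.
have {}gK y : g y *: x1 = y by rewrite -qE gK.
have gE y : g y = g y * g x1 by rewrite -{1}(gK y) linearZ.
have g_inj : injective g by move=> x y gxy; rewrite -(gK x) gxy gK.
exists (g x1), g; split; [split|split].
- by rewrite -gE.
- exact: g_inj.
- move=> x; split=> [[y <-]|xe]; first by rewrite -gE.
  by exists (x *: x1); rewrite linearZ.
- by exists l0 => //; rewrite -px1 -linearZ gK.
move=> X X_simple [x0 ex0].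
have [|phi phiE] := @linear_of P X (fun y => (g y : B) *: x0).
  by move=> a x y; rewrite linearP scalerDl scalerA.
have phi_onto z : exists y, phi y = z.
  move: z; apply: (simple_sub (P := fun z => exists y, phi y = z) X_simple).
    by move=> a _ _ [y <-] [y' <-]; exists (a *: y + y'); rewrite linearP.
  by exists (phi x1); [exists x1 | rewrite phiE].
(* Otherwise [p] maps the kernel of [phi] onto [L], and this kernel is
   everything because that of [p] is superfluous. *)
have ker_phi x : phi x = 0 -> p x = 0.
  move=> phix0; apply/eqP/negP => /negP px0.
  have [||K KP] := @submod_of_Prop P (fun x => phi x = 0).
  - exact: raddf0.
  - by move=> a u v u0 v0; rewrite linearP u0 v0 scaler0 addr0.
  have : x1 \in K.
    rewrite (p_small K) // => y.
    have [u u0 pu] : exists2 u, phi u = 0 & p u = p y.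
      move: (p y).
      apply: (simple_sub (P := fun l => exists2 u, phi u = 0 & p u = l) L_simple).
        move=> a _ _ [u u0 <-] [v v0 <-]; exists (a *: u + v).
          by rewrite linearP u0 v0 scaler0 addr0.
        by rewrite linearP.
      by exists (p x) => //; exists x.
    by exists u; [apply/KP | rewrite raddfB /= pu subrr].
  by move/KP => phi1; move: ex0; rewrite -phiE phi1 eqxx.
have /choice[s sK] := phi_onto.
(* So [p] factors through [phi]. *)
have ps z y : phi y = z -> p (s z) = p y.
  move=> phiy; apply/eqP; rewrite -subr_eq0 -raddfB; apply/eqP/ker_phi.
  by rewrite raddfB /= sK phiy subrr.
have [|psi psiE] := @linear_of X L (fun z => p (s z)).
  move=> a u v; rewrite (ps _ (a *: s u + s v)) ?linearP //.
  by rewrite !sK.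
exists psi; apply: inj_surj_bij => [u v|l]; last first.
  have [y <-] := p_onto l; exists (phi y).
  by rewrite psiE (ps _ y).
move=> psi_uv; apply: contrapT => uv.
have psi0 : forall z, psi z = 0.
  apply: (simple_sub (P := fun z => psi z = 0) X_simple).
    by move=> a z z' z0 z'0; rewrite linearP z0 z'0 scaler0 addr0.
  exists (u - v); first by rewrite raddfB /= psi_uv subrr.
  by rewrite subr_eq0; apply/eqP.
have := psi0 (phi x1); rewrite psiE (ps _ x1) // px1.
by move/eqP; rewrite (negPf l00).
Qed.

End ModuleTools.

(** * Composition multiplicities as dimensions *)

Section Dimension.
Variables (k : fieldType) (B : pzRingType) (kB : {rmorphism k -> B}).
Hypothesis kB_central : central_map kB.

Definition kcomb (M : lmodType B) d (b : 'I_d -> M) (v : 'rV[k]_d) : M :=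
  \sum_i kB (v 0 i) *: b i.

(** [S] has a basis of [d] vectors over [k]. Rather than restricting scalars on [M],
    the field acts through [kB]. *)
Definition has_dim (M : lmodType B) (S : M -> Prop) (d : nat) : Prop :=
  exists b : 'I_d -> M, [/\ forall i, S (b i), forall x, S x -> exists v, x = kcomb b v
    & forall v, kcomb b v = 0 -> v = 0].

Lemma kcombB (M : lmodType B) d (b : 'I_d -> M) u v :
  kcomb b (u - v) = kcomb b u - kcomb b v.
Proof.
rewrite /kcomb -sumrB; apply: eq_bigr => i _.
by rewrite !mxE rmorphB scalerBl.
Qed.

Lemma kcombZ (M : lmodType B) d (b : 'I_d -> M) r v :
  kcomb b (r *: v) = kB r *: kcomb b v.
Proof.
rewrite /kcomb scaler_sumr; apply: eq_bigr => i _.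
by rewrite mxE rmorphM scalerA.
Qed.

Lemma kcomb_row_mx (M : lmodType B) d1 d2 (b : 'I_(d1 + d2) -> M)
    (u : 'rV[k]_d1) (v : 'rV[k]_d2) :
  kcomb b (row_mx u v) = kcomb (b \o lshift d2) u + kcomb (b \o @rshift d1 d2) v.
Proof.
rewrite /kcomb big_split_ord /=; congr (_ + _); apply: eq_bigr => i _.
  by rewrite row_mxEl.
by rewrite row_mxEr.
Qed.

Lemma linear_kcomb (M N : lmodType B) (f : {linear M -> N}) d (b : 'I_d -> M) v :
  f (kcomb b v) = kcomb (f \o b) v.
Proof. by rewrite linear_sum; apply: eq_bigr => i _; rewrite linearZ. Qed.

(** A spanning family of minimal size is free. *)
Lemma has_dim_exists (M : lmodType B) (S : M -> Prop) :
    (exists n (b : 'I_n -> M), (forall i, S (b i)) /\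
       forall x, S x -> exists v, x = kcomb b v) ->
  exists d, has_dim S d.
Proof.
move=> ex_b.
pose P n := `[< exists b : 'I_n -> M, (forall i, S (b i)) /\
  forall x, S x -> exists v, x = kcomb b v >].
have exP : exists n, P n by have [n hn] := ex_b; exists n; apply/asboolP.
case: (ex_minnP exP) => n /asboolP[b [bS b_span]] n_min.
exists n, b; split=> // v bv0; apply: contrapT => v0.
case: n => [|n] in b bS b_span v bv0 v0 {exP} n_min *.
  by apply: v0; apply/rowP => -[].
have [j vj0] : exists j, v 0 j != 0.
  apply: contrapT => v_0; apply: v0; apply/rowP => j; rewrite mxE.
  by apply: contrapT => vj; apply: v_0; exists j; apply/eqP.
suff : (n.+1 <= n)%N by rewrite ltnn.
apply/n_min/asboolP; exists (b \o lift j); split=> [i|x xS]; first exact: bS.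
have [w ->] := b_span x xS; pose w' := w - (w 0 j / v 0 j) *: v.
exists (\row_i w' 0 (lift j i)).
have -> : kcomb b w = kcomb b w' by rewrite kcombB kcombZ bv0 scaler0 subr0.
have w'j : w' 0 j = 0 by rewrite !mxE mulfVK // subrr.
rewrite {1}/kcomb (bigD1_ord j) //= w'j rmorph0 scale0r add0r.
by apply: eq_bigr => i _; rewrite mxE.
Qed.

Lemma has_dim0 (M : lmodType B) (S : M -> Prop) :
  (forall x, S x -> x = 0) -> has_dim S 0.
Proof.
move=> S0; exists (fun=> 0); split=> [[]//|x /S0 ->|v _].
  by exists 0; rewrite /kcomb big_ord0.
by apply/rowP => -[].
Qed.

Lemma has_dim_eq (M : lmodType B) (S S' : M -> Prop) d :
  (forall x, S x <-> S' x) -> has_dim S d -> has_dim S' d.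
Proof.
move=> SS' [b [bS b_span b_free]]; exists b.
by split=> // [i|x /SS'/b_span//]; apply/SS'.
Qed.

Variable e : B.
Hypothesis ee : e * e = e.

Lemma scale_kB r (M : lmodType B) (x : M) : e *: (kB r *: x) = kB r *: (e *: x).
Proof. by rewrite !scalerA kB_central. Qed.

Lemma kcomb_fixed (M : lmodType B) d (b : 'I_d -> M) v :
  (forall i, e *: b i = b i) -> e *: kcomb b v = kcomb b v.
Proof.
by move=> eb; rewrite scaler_sumr; apply: eq_bigr => i _; rewrite scale_kB eb.
Qed.

Lemma kcomb_sub (M : lmodType B) (N : submodClosed M) d (b : 'I_d -> M) v :
  (forall i, b i \in N) -> kcomb b v \in N.
Proof. by move=> bN; apply: rpred_sum => i _; apply: rpredZ. Qed.

Lemma has_dim_isom (X L : lmodType B) d : lmod_isom X L ->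
  has_dim (fun x : L => e *: x = x) d -> has_dim (fun x : X => e *: x = x) d.
Proof.
move=> [f [g fK gK]] [b [bS b_span b_free]].
have f_inj := can_inj fK.
have fgb : forall v, f (kcomb (g \o b) v) = kcomb b v.
  by move=> v; rewrite linear_kcomb; apply: eq_bigr => i _; rewrite /= gK.
exists (g \o b); split=> [i|x ex|v].
- by apply: f_inj; rewrite linearZ /= gK bS.
- have [|v fx] := b_span (f x); first by rewrite -linearZ ex.
  by exists v; apply: f_inj; rewrite fgb.
- by move=> /(congr1 f); rewrite fgb raddf0 => /b_free.
Qed.

(** A total function on [M] takes the place of the projection of the subtype of
    [N], so that bases can be chosen in [M]. *)
Lemma subquot_projection (M : lmodType B) (N N' : submodClosed M) :
  exists q : M -> subquot N N',
  [/\ forall a x y, x \in N -> y \in N -> q (a *: x + y) = a *: q x + q y,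
      forall x, x \in N -> (q x = 0 <-> x \in N')
    & forall z, exists2 x, x \in N & q x = z].
Proof.
have [pi [pi_onto pi0]] := lmod_quot_projection (submod_restrict (N := N) N').
exists (fun x => pi (insubd 0 x)); split=> [a x y xN yN|x xN|z].
- rewrite -linearP; congr (pi _); apply/val_inj.
  by rewrite /= !insubdK // rpredD // rpredZ.
- split=> [/pi0|xN'].
    by rewrite unfold_in /submod_restrict insubdK.
  by apply/pi0; rewrite unfold_in /submod_restrict insubdK.
- have [x <-] := pi_onto z; exists (val x); first exact: (valP x).
  by rewrite valKd.
Qed.

(** Since [e] is idempotent, [x |-> e *: x] lifts the fixed vectors of the
    quotient to fixed vectors of [N]. *)
Lemma has_dim_extension (M : lmodType B) (N N' : submodClosed M) d1 d2 :
    {subset N' <= N} ->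
    has_dim (fun x : M => x \in N' /\ e *: x = x) d1 ->
    has_dim (fun x : subquot N N' => e *: x = x) d2 ->
  has_dim (fun x : M => x \in N /\ e *: x = x) (d1 + d2).
Proof.
move=> sN [b1 [b1S b1_span b1_free]] [b2 [b2S b2_span b2_free]].
have [q [qP q0 q_onto]] := subquot_projection N N'.
have N0 : 0 \in N by apply: rpred0.
have q00 : q 0 = 0 by apply/q0; rewrite ?rpred0.
have qZ a x : x \in N -> q (a *: x) = a *: q x.
  by move=> xN; rewrite -[a *: x]addr0 qP // q00 addr0.
have qB x y : x \in N -> y \in N -> q (x - y) = q x - q y.
  by move=> xN yN; rewrite addrC -scaleN1r qP // scaleN1r addrC.
have q_kcomb d (b : 'I_d -> M) v : (forall i, b i \in N) ->
    q (kcomb b v) = kcomb (q \o b) v.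
  move=> bN; have: \sum_i kB (v 0 i) *: b i \in N /\
      q (\sum_i kB (v 0 i) *: b i) = \sum_i kB (v 0 i) *: q (b i).
    elim/big_rec2: _ => [//|i x y _ [yN qy]]; split; first by rewrite rpredD // rpredZ.
    by rewrite qP // qy.
  by case.
have /choice[y yP] i : exists y, [/\ y \in N, e *: y = y & q y = b2 i].
  have [x xN qx] := q_onto (b2 i); exists (e *: x); split.
  - exact: rpredZ.
  - by rewrite scalerA ee.
  - by rewrite qZ // qx b2S.
have yN i : y i \in N by case: (yP i).
have qy v : q (kcomb y v) = kcomb b2 v.
  by rewrite q_kcomb //; apply: eq_bigr => i _; rewrite /=; case: (yP i) => _ _ ->.
pose b i := match split i with inl j => b1 j | inr j => y j end.
have bE u v : kcomb b (row_mx u v) = kcomb b1 u + kcomb y v.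
  rewrite kcomb_row_mx; congr (_ + _); apply: eq_bigr => i _; congr (_ *: _).
    by rewrite /b /= (unsplitK (inl i)).
  by rewrite /b /= (unsplitK (inr i)).
exists b; split=> [i|x [xN ex]|v].
- rewrite /b; case: (split i) => j; last by case: (yP j).
  by have [jN' ej] := b1S j; split; first exact: sN.
- have [|v qx] := b2_span (q x); first by rewrite -qZ // ex.
  have yvN : kcomb y v \in N by apply: kcomb_sub.
  have xyN : x - kcomb y v \in N by rewrite -scaleN1r rpredD // rpredZ.
  have [|u xu] := b1_span (x - kcomb y v).
    split; first by apply: (proj1 (q0 _ xyN)); rewrite qB // qy qx subrr.
    rewrite scalerBr ex kcomb_fixed // => i.
    by case: (yP i).
  by exists (row_mx u v); rewrite bE -xu subrK.
- rewrite -[v]hsubmxK bE => uv0.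
  have b1N i : b1 i \in N by apply: sN; case: (b1S i).
  have v0 : rsubmx v = 0.
    apply: b2_free; rewrite -qy.
    have -> : kcomb y (rsubmx v) = 0 - kcomb b1 (lsubmx v) by rewrite -uv0 addrC addKr.
    rewrite qB ?kcomb_sub // q00 sub0r; apply/eqP; rewrite oppr_eq0; apply/eqP/q0.
      exact: kcomb_sub.
    by apply: kcomb_sub => i; case: (b1S i).
  move: uv0; rewrite v0 {2}/kcomb big1 ?addr0; last first.
    by move=> i _; rewrite mxE rmorph0 scale0r.
  by move/b1_free ->; rewrite row_mx0.
Qed.

(** [dim (e M)] counts the composition factors on which [e] does not vanish. *)
Lemma composition_dim (M L : lmodType B) c d :
    has_dim (fun x : L => e *: x = x) d ->
    (forall X : lmodType B, simple_module X ->
       (exists x : X, e *: x != 0) -> lmod_isom X L) ->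
    composition_multiplicity M L c ->
  has_dim (fun x : M => e *: x = x) (d * c).
Proof.
move=> L_dim e_only [r [F [F0 Fr F_simple ->]]].
pose m j : nat := `[< lmod_isom (subquot (F j.+1) (F j)) L >].
have F_dim l : (l <= r)%N ->
    has_dim (fun x : M => x \in F l /\ e *: x = x) (d * \sum_(j < l) m j).
  elim: l => [_|l IHl lt_lr].
    rewrite big_ord0 muln0; apply: has_dim0 => x [+ _].
    by rewrite F0 => /eqP.
  have [F_sub X_simple] := F_simple l lt_lr.
  rewrite big_ord_recr mulnDr /=.
  apply: (has_dim_extension F_sub); first exact: IHl (ltnW lt_lr).
  rewrite /m; have [X_L|X_nL] := asboolP (lmod_isom _ _).
    by rewrite muln1; apply: has_dim_isom L_dim.
  rewrite muln0; apply: has_dim0 => x ex; apply: contrapT => x0.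
  by apply/X_nL/e_only => //; exists x; rewrite ex; apply/eqP.
have := F_dim r (leqnn r).
have -> : #|[set j : 'I_r | `[< lmod_isom (subquot (F j.+1) (F j)) L >]]| =
    \sum_(j < r) m j.
  by rewrite -sum1dep_card big_mkcond; apply: eq_bigr => j _; rewrite /m; case: ifP.
by apply: has_dim_eq => x; rewrite Fr; split=> [[]|].
Qed.

End Dimension.

(** * Cartan matrices of blocks *)

Lemma natr_inj_pchar0 (k : fieldType) (a b : nat) :
  [pchar k] =i pred0 -> a%:R = b%:R :> k -> a = b.
Proof.
move=> /pcharf0P k0; wlog le_ab : a b / (a <= b)%N => [wlog_ab|ab].
  by have [/wlog_ab|/ltnW/wlog_ab h /esym/h] := leqP a b.
apply/eqP; rewrite eqn_leq le_ab /= -subn_eq0 -k0 natrB // ab subrr eqxx //.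
Qed.

Section BlockCartan.
Variables (k : fieldType) (A : nzRingType) (kap : {rmorphism k -> A}).
Hypothesis k_char0 : [pchar k] =i pred0.
Variables (n : nat) (C : coords k A n).
Hypothesis kap_acts : forall c, acts_as C (kap c) c.
Hypothesis C_basis : forall x, x = \sum_i kap (C x 0 i) * cb C i.
Variables (D : block_decomposition A) (i : 'I_(nblocks D)).
Notation B := (block i).
Notation c := (one_component i).

Lemma block_scalars : exists kB : {rmorphism k -> B}, forall r, val (kB r) = kap r * c.
Proof.
have kap_in r : kap r * c \in block_ideal i by apply/Defs.idealMl/one_component_in.
pose f r : B := Block (kap_in r).
have fB : zmod_morphism f by move=> x y; apply: val_inj; rewrite /= rmorphB mulrBl.
have fM : monoid_morphism f.
  split=> [|x y]; apply: val_inj; first by rewrite /= rmorph1 mul1r.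
  rewrite /= rmorphM -!mulrA; congr (_ * _).
  by rewrite [RHS]block_mul1 //; apply: kap_in.
by exists (HB.pack_for {rmorphism k -> B} f
  (GRing.isZmodMorphism.Build _ _ f fB) (GRing.isMonoidMorphism.Build _ _ f fM)).
Qed.

Variable kB : {rmorphism k -> B}.
Hypothesis kBE : forall r, val (kB r) = kap r * c.

Lemma block_valM (x y : B) : val (x * y) = val x * val y. Proof. by []. Qed.

Lemma block_scalarM r (x : B) : val (kB r * x) = kap r * val x.
Proof. by rewrite block_valM kBE -mulrA (block_mul1 (valP x)). Qed.

Lemma block_scalars_central : central_map kB.
Proof.
move=> r x; apply: val_inj; rewrite block_scalarM block_valM kBE mulrA.
by rewrite -(kapC kap_acts) -mulrA (block_mulr1 (valP x)).
Qed.

Lemma block_one_neq0 : (1 : B) != 0.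
Proof.
have [[x xI x0] _] := block_indecomposable i.
apply: contraNneq x0 => B10.
by rewrite -(block_mul1 xI) -[c]/(val (1 : B)) B10 mul0r.
Qed.

(** [L] is generated by [x0], hence spanned over [k] by the images of a basis of
    the block. *)
Lemma has_dim_fixed_simple (L : lmodType B) (e : B) : e * e = e -> simple_module L ->
    (exists2 x : L, x != 0 & e *: x = x) ->
  exists d, has_dim kB (fun x : L => e *: x = x) d.
Proof.
move=> ee L_simple [x0 x00 ex0]; apply: has_dim_exists.
have be_in l : cb C l * c \in block_ideal i by apply/Defs.idealMl/one_component_in.
pose be l : B := Block (be_in l).
have beE (b : B) : b = \sum_l kB (C (val b) 0 l) * be l.
  apply: val_inj; rewrite (big_morph (fun x : B => val x) (id1 := 0) (op1 := +%R)) //.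
  rewrite -(block_mulr1 (valP b)) {1}(C_basis (val b)) mulr_suml.
  apply: eq_bigr => l _; rewrite block_scalarM /= mulrA.
  by rewrite (block_mulr1 (valP b)).
have L_gen x : exists b : B, x = b *: x0.
  move: x; apply: (simple_sub (P := fun x => exists b : B, x = b *: x0) L_simple).
    by move=> a _ _ [b ->] [b' ->]; exists (a * b + b'); rewrite scalerDl scalerA.
  by exists x0 => //; exists 1; rewrite scale1r.
exists n.+1, (fun l => (e * be l) *: x0); split=> [l|x ex].
  by rewrite scalerA mulrA ee.
have [b xb] := L_gen x; exists (C (val b)).
rewrite -ex xb {1}(beE b) scaler_suml scaler_sumr; apply: eq_bigr => l _.
by rewrite -!scalerA scale_kB //; apply: block_scalars_central.
Qed.

(** A basis of [e1 P] for [P = B e2] is a basis of [e1 A e2], the image of the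
    idempotent operator [x |-> e1 * x * e2]. *)
Lemma bitrace_has_dim (e1 e2 : B) (P : lmodType B) (g : {linear P -> B^o}) d :
    e1 * e1 = e1 -> e2 * e2 = e2 -> injective g ->
    (forall x : B, (exists y, g y = x) <-> x * e2 = x) ->
    has_dim kB (fun x : P => e1 *: x = x) d ->
  bitrace C (val e1) (val e2) = d%:R.
Proof.
move=> e11 e22 g_inj gP [b [bS b_span b_free]].
pose w l : A := val (g (b l) : B).
have wE v : val (g (kcomb kB b v) : B) = \sum_l kap (v 0 l) * w l.
  rewrite linear_sum (big_morph (fun x : B => val x) (id1 := 0) (op1 := +%R)) //.
  by apply: eq_bigr => l _; rewrite linearZ; apply: block_scalarM.
pose W : 'M[k]_(d, n.+1) := \matrix_l C (w l).
have CwE v : C (val (g (kcomb kB b v) : B)) = v *m W.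
  rewrite wE mulmx_sum_row raddf_sum; apply: eq_bigr => l _.
  by rewrite rowK /= (proj2 (kap_acts _)).
pose E := Lm C (val e1) *m Rm C (val e2).
have WE : W *m E = W.
  apply/row_matrixP => l; rewrite row_mul rowK /E mulmxA -co_Lm -co_Rm; congr (C _).
  rewrite -!block_valM; congr (val _).
  have -> : e1 * (g (b l) : B) = g (b l) by rewrite -[in RHS](bS l) linearZ.
  by apply/gP; exists (b l).
have W_free : row_free W.
  apply: inj_row_free => v vW; apply: b_free; apply: g_inj; apply: val_inj.
  by apply: (@co_inj _ _ _ C); rewrite CwE vW !raddf0.
have /choice[U EU] l : exists v : 'rV_d, row l E = v *m W.
  have bl_in : cb C l * c \in block_ideal i by apply/Defs.idealMl/one_component_in.
  pose y := e1 * Block bl_in * e2.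
  have Cy : C (val y) = row l E.
    rewrite /E row_mul rowK -co_Rm !block_valM /= !mulrA.
    by rewrite -(mulrA _ c) (block_mul1 (valP e2)).
  have [|p gp] := (gP y).2; first by rewrite -mulrA e22.
  have [|v pv] := b_span p.
    by apply: g_inj; rewrite linearZ gp /= -[LHS]/(e1 * y) !mulrA e11.
  by exists v; rewrite -Cy -gp pv CwE.
pose V : 'M_(n.+1, d) := \matrix_l U l.
have EVW : E = V *m W by apply/row_matrixP => l; rewrite EU row_mul rowK.
have WV : W *m V = 1%:M.
  by apply: (row_free_inj W_free); rewrite mul1mx -mulmxA -EVW.
by rewrite /bitrace -/E EVW mxtrace_mulC WV mxtrace1.
Qed.

Variable N : nat.
Hypothesis central_part : forall b, exists t, central t /\
  forall a, bitrace C a b *+ N.+1 = bitrace C a t.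

Let block_in : c \in block_ideal i := one_component_in i.
Let block_unitl : {in block_ideal i, forall x, c * x = x} := @block_mul1 A D i.
Let block_unitr : {in block_ideal i, forall x, x * c = x} := @block_mulr1 A D i.

Lemma bitrace_block_idem (e e' : B) a : e * e = e -> e' * e' = e' ->
  \tr (Rm C (val e')) * bitrace C a (val e) = \tr (Rm C (val e)) * bitrace C a (val e').
Proof.
move=> ee ee'.
have vee : val e * val e = val e by rewrite -block_valM ee.
have vee' : val e' * val e' = val e' by rewrite -block_valM ee'.
have idem := bitrace_idem k_char0 kap_acts block_in block_unitl block_unitr
  (block_indecomposable i) central_part.
have trc0 : \tr (Rm C c) != 0.
  rewrite (trace_idem_eq0 k_char0) ?block_unitl //.
  exact: (block_unit_neq0 block_unitl (block_indecomposable i)).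
apply: (mulfI trc0); rewrite mulrCA (idem _ a (valP e) vee).
by rewrite [RHS]mulrCA (idem _ a (valP e') vee') mulrCA.
Qed.

(** With [P i = B e_i], the entry [Cm i j] is proportional, with a factor
    depending only on [j], to [bitrace e_j e_i]; as functions of the first argument
    the [bitrace _ e_i] are all proportional. *)
Lemma cartan_rank1 m (Cm : 'M[nat]_m) : is_cartan_matrix B Cm ->
  \rank (map_mx (fun x : nat => x%:R : rat) Cm) = 1%N.
Proof.
move=> [L [P [p [[L_simple L_inj L_all] P_cover Cm_mult]]]].
have /choice[e eP] j := projective_cover_idempotent (L_simple j) (P_cover j).
pose g j := projT1 (cid (eP j)).
have egP j := projT2 (cid (eP j)).
have ee j : e j * e j = e j by case: (egP j) => -[].
have /choice[d dP] j : exists d, has_dim kB (fun x : L j => e j *: x = x) d.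
  by case: (egP j) => _ [Lx _]; apply: has_dim_fixed_simple.
have kBC := block_scalars_central.
have eP_dim j l : has_dim kB (fun x : P l => e j *: x = x) (d j * Cm l j).
  by case: (egP j) => _ [_ eX]; apply: (composition_dim kBC (ee j) (dP j) eX).
have bitr j l : bitrace C (val (e j)) (val (e l)) = (d j * Cm l j)%:R.
  case: (egP l) => [[_ g_inj gP] _].
  exact: bitrace_has_dim (ee j) (ee l) g_inj gP (eP_dim j l).
pose r j := \rank (Rm C (val (e j))).
have trE j : \tr (Rm C (val (e j))) = (r j)%:R.
  by rewrite mxtrace_idem // -RmM -block_valM ee.
have e0 j : e j != 0.
  case: (egP j) => _ [[x x0 ex] _].
  by apply: contraNneq x0 => ej0; rewrite -ex ej0 scale0r.
have r_gt0 j : (0 < r j)%N.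
  rewrite lt0n mxrank_eq0; apply: contraNneq (e0 j) => R0.
  by apply/eqP; apply: val_inj; apply: (@Rm_inj _ _ _ C); rewrite R0 !raddf0.
have d_gt0 j : (0 < d j)%N.
  rewrite lt0n; apply/eqP => dj0; have := dP j; rewrite dj0 => -[b [_ b_span _]].
  case: (egP j) => _ [[x x0 /b_span[v xv]] _].
  by move: x0; rewrite xv /kcomb big_ord0 eqxx.
have rC j l l' : (r l' * Cm l j = r l * Cm l' j)%N.
  apply/eqP; rewrite -(eqn_pmul2l (d_gt0 j)); apply/eqP.
  apply: (natr_inj_pchar0 k_char0); rewrite mulnCA [in RHS]mulnCA natrM [RHS]natrM.
  by rewrite -!bitr -!trE; apply: bitrace_block_idem.
have [M M_simple] := simple_module_exists block_one_neq0.
have [i0 _] := L_all M M_simple.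
have Cii : Cm i0 i0 != 0%N.
  apply/eqP => C0; have := eP_dim i0 i0; rewrite C0 muln0 => -[b [_ b_span _]].
  case: (egP i0) => [[_ g_inj gP] _].
  have [|y gy] := (gP (e i0)).2; first exact: ee.
  have [|v yv] := b_span y.
    by apply: g_inj; rewrite linearZ gy; apply: ee.
  have := e0 i0; rewrite -gy yv /kcomb big_ord0.
  by rewrite (raddf0 (g i0)) eqxx.
set CQ := map_mx _ _.
have r0 : (r i0)%:R != 0 :> rat by rewrite Num.Theory.pnatr_eq0 -lt0n.
have CQE : CQ = (\col_l ((r l)%:R / (r i0)%:R)) *m row i0 CQ.
  apply/matrixP => l j; rewrite !mxE big_ord1 !mxE.
  apply: (mulfI r0); rewrite mulrA mulrCA divff // mulr1 -!natrM.
  by rewrite rC.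
apply/eqP; rewrite eqn_leq; apply/andP; split.
  by rewrite CQE mulmx_max_rank.
rewrite lt0n mxrank_eq0; apply/eqP => /matrixP/(_ i0 i0).
by rewrite !mxE => /eqP; rewrite Num.Theory.pnatr_eq0 (negPf Cii).
Qed.

End BlockCartan.

Theorem rank_one_of_central_part (k : fieldType) (A : nzRingType)
    (kap : {rmorphism k -> A}) n (C : coords k A n) N :
    [pchar k] =i pred0 -> (forall r, acts_as C (kap r) r) ->
    (forall x, x = \sum_i kap (C x 0 i) * cb C i) ->
    (forall b, exists t, central t /\
      forall a, bitrace C a b *+ N.+1 = bitrace C a t) ->
  rank_one_property A.
Proof.
move=> k0 kap_acts C_basis central_part D i m Cm.
have [kB kBE] := block_scalars kap i.
exact: (cartan_rank1 k0 kap_acts C_basis kBE central_part).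
Qed.

(** * Reduction modulo a maximal ideal *)

Lemma ring_quot_projection (H : pzRingType) (I : ideal H) :
  exists pi : {rmorphism H -> ring_quot I},
    (forall y, exists x, pi x = y) /\ (forall x, pi x = 0 <-> x \in I).
Proof.
pose f := ring_proj I.
have fD x y : f (x + y) = f x + f y by rewrite [RHS]ring_projD.
have f0 : f 0 = 0 by apply: (addrI (f 0)); rewrite -fD !addr0.
have fB : zmod_morphism f.
  by move=> x y; apply: (addIr (f y)); rewrite -fD !subrK.
have fM : monoid_morphism f by split=> // x y; rewrite [RHS]ring_projM.
exists (HB.pack_for {rmorphism H -> ring_quot I} f
  (GRing.isZmodMorphism.Build _ _ f fB) (GRing.isMonoidMorphism.Build _ _ f fM)).
split=> [y|x] /=; first by have [x ->] := ring_quotP y; exists x.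
have := Quotient.idealrBE I x 0; rewrite subr0 => xI.
rewrite -f0; split=> [/eqP e|xI']; first by rewrite [_ \in _]xI.
by apply/eqP; rewrite -[_ == _]xI.
Qed.

Lemma residue_field (R : comPzRingType) (m : ideal R) : maximal_ideal m ->
  exists (k : fieldType) (phi : {rmorphism R -> k}),
    (forall y, exists x, phi x = y) /\ (forall x, phi x = 0 <-> x \in m).
Proof.
move=> [m1 m_max]; have [pi [pi_onto pi0]] := ring_quot_projection m.
have Q_mulC : commutative (@GRing.mul (ring_quot m)).
  move=> x y; have [[x' <-] [y' <-]] := conj (pi_onto x) (pi_onto y).
  by rewrite -!rmorphM mulrC.
pose Q : comPzRingType := HB.pack_for comPzRingType (ring_quot m)
  (GRing.PzRing_hasCommutativeMul.Build (ring_quot m) Q_mulC).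
have [||k [f [h [fK hK]]]] := @field_of_inverses Q.
- by apply/eqP; rewrite -(rmorph1 pi) => /pi0; apply/negP.
- move=> y; have [x <-] := pi_onto y => x0.
  have [|u v [a [r [am ->]]] [b [s [bm ->]]]|u _ [a [r [am ->]]]
      |u _ [a [r [am ->]]]|J JP] :=
      @ideal_of_Prop R (fun z => exists a r, a \in m /\ z = a + r * x).
  - by exists 0, 0; rewrite rpred0 mul0r addr0.
  - by exists (a - b), (r - s); rewrite rpredB //; split=> //; ring.
  - by exists (u * a), (u * r); rewrite Defs.idealMl //; split=> //; ring.
  - by exists (u * a), (u * r); rewrite Defs.idealMl //; split=> //; ring.
  have [|J1] := pselect (1 \in J).
    move=> /JP[a [r [am e1]]]; exists (pi r).
    rewrite -[LHS]rmorphM -[RHS](rmorph1 pi) e1 rmorphD.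
    by rewrite ((pi0 a).2 am) add0r.
  case/negP: x0; apply/eqP/pi0; apply: (m_max J).
  - by move=> a am; apply/JP; exists a, 0; rewrite mul0r addr0.
  - exact/negP.
  - by apply/JP; exists 0, 1; rewrite rpred0 mul1r add0r.
exists k, (f \o pi); split=> [y|x].
  by have [x px] := pi_onto (h y); exists x; rewrite /= px hK.
rewrite -pi0 /=; split=> [e|->]; last exact: rmorph0.
by apply: (can_inj fK); rewrite e rmorph0.
Qed.

Section Reduction.
Variables (R : comNzRingType) (H : nzRingType) (iota : {rmorphism R -> H}).
Hypothesis iotaC : central_map iota.
Variables (n : nat) (C : coords R H n).
Hypothesis C_acts : forall r, acts_as C (iota r) r.
Hypothesis C_basis : forall x, x = \sum_i iota (C x 0 i) * cb C i.
Variables (k : fieldType) (phi : {rmorphism R -> k}).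
Hypothesis phi_onto : forall y, exists x, phi x = y.
Variables (A : nzRingType) (pi : {rmorphism H -> A}).
Hypothesis pi_onto : forall y, exists x, pi x = y.
Hypothesis pi_ker : forall x, pi x = 0 <-> map_mx phi (C x) = 0.

Lemma reduced_scalars : exists kap : {rmorphism k -> A},
  central_map kap /\ forall r, kap (phi r) = pi (iota r).
Proof.
have /choice[s sK] := phi_onto.
have sE r : pi (iota (s (phi r))) = pi (iota r).
  apply/eqP; rewrite -subr_eq0 -!rmorphB; apply/eqP/pi_ker.
  have [_ /(_ 1)] := C_acts (s (phi r) - r); rewrite mulr1 => ->.
  by rewrite map_mxZ rmorphB /= sK subrr scale0r.
pose f x := pi (iota (s x)).
have fphi r : f (phi r) = pi (iota r) by apply: sE.
have fB : zmod_morphism f.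
  by move=> x y; rewrite -(sK x) -(sK y) -rmorphB !fphi !rmorphB.
have fM : monoid_morphism f.
  split=> [|x y]; first by rewrite -(rmorph1 phi) fphi !rmorph1.
  by rewrite -(sK x) -(sK y) -rmorphM !fphi !rmorphM.
exists (HB.pack_for {rmorphism k -> A} f
  (GRing.isZmodMorphism.Build _ _ f fB) (GRing.isMonoidMorphism.Build _ _ f fM)).
split=> // r y; have [x <-] := pi_onto y.
by rewrite /= /f -!rmorphM iotaC.
Qed.

(** A basis of [H] over [R] reduces to a basis of [A] over [k], and the matrices
    of multiplications reduce accordingly. *)
Lemma reduced_coords (kap : {rmorphism k -> A}) : central_map kap ->
    (forall r, kap (phi r) = pi (iota r)) ->
  exists CA : coords k A n, [/\ forall r, acts_as CA (kap r) r,
    forall x, x = \sum_i kap (CA x 0 i) * cb CA i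
    & forall a b, bitrace CA (pi a) (pi b) = phi (bitrace C a b)].
Proof.
move=> kapC kap_phi.
have pi_comb (r : 'I_n.+1 -> R) :
    pi (\sum_i iota (r i) * cb C i) = \sum_i kap (phi (r i)) * pi (cb C i).
  by rewrite rmorph_sum; apply: eq_bigr => i _; rewrite rmorphM kap_phi.
have C_comb (r : 'I_n.+1 -> R) : C (\sum_i iota (r i) * cb C i) = \row_i r i.
  rewrite raddf_sum (row_sum_delta (\row_i r i)); apply: eq_bigr => i _ /=.
  by rewrite (proj2 (C_acts _)) co_cb mxE.
have [||CA [cbE CA_acts CA_basis]] := @free_coords k A kap kapC n (pi \o cb C).
- move=> y; have [x <-] := pi_onto y; exists (fun i => phi (C x 0 i)).
  by rewrite {1}(C_basis x) pi_comb.
- move=> c; have /choice[r rc] i := phi_onto (c i) => c0 i.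
  have /pi_ker : pi (\sum_i iota (r i) * cb C i) = 0.
    by rewrite pi_comb -[RHS]c0; apply: eq_bigr => j _; rewrite rc.
  by rewrite C_comb => /rowP/(_ i); rewrite !mxE rc.
have CA_pi x : CA (pi x) = map_mx phi (C x).
  rewrite {1}(C_basis x) pi_comb raddf_sum [RHS]row_sum_delta.
  apply: eq_bigr => i _.
  rewrite [LHS](proj2 (CA_acts _)) mxE -[pi (cb C i)]/((pi \o cb C) i) -cbE.
  by rewrite co_cb.
exists CA; split=> // [x|a b]; first by rewrite cbE.
rewrite /bitrace.
have -> : Lm CA (pi a) = map_mx phi (Lm C a).
  by apply/row_matrixP => i; rewrite -map_row !rowK cbE /= -rmorphM CA_pi.
have -> : Rm CA (pi b) = map_mx phi (Rm C b).
  by apply/row_matrixP => i; rewrite -map_row !rowK cbE /= -rmorphM CA_pi.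
by rewrite -map_mxM trace_map_mx.
Qed.

End Reduction.

Theorem theorem1p1
  (K : closedFieldType) (charK0 : [pchar K] =i pred0)
  (H : algType K) (H_affine : affine_algebra H)
  (R : comAlgType K) (iota : {lrmorphism R -> H})
  (iota_inj : injective iota) (iota_central : central_map iota)
  (H_frobenius : free_frobenius_extension iota)
  (R_regular : regular_ring R)
  (H_prime : prime_ring H)
  (Z_gorenstein : gorenstein_ring (centre H))
  (Z_int_closed : integrally_closed_domain (centre H))
  (m : ideal R) (m_maximal : maximal_ideal m) :
  rank_one_property (ring_quot (ext_ideal m iota_central)).
Proof.
have [[[|n] [b [b_span b_free]]] _] := H_frobenius.
  have [c /eqP] := b_span 1.
  by rewrite big_ord0 oner_eq0.
have [C [cbE C_acts C_basis]] := free_coords iota_central b_span b_free.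
rewrite -cbE in C_basis.
have K_char0 j : j.+1%:R != 0 :> K by rewrite (proj1 (@pcharf0P K) charK0).
have H_char0 j : j.+1%:R != 0 :> H.
  by rewrite -scaler_nat scaler_eq0 (negPf (K_char0 j)) oner_eq0.
have [N central_part] := bitrace_central_part iota_inj iota_central H_prime
  Z_int_closed H_char0 C_acts C_basis.
have [k [phi [phi_onto phi0]]] := residue_field m_maximal.
have k_char0 : [pchar k] =i pred0.
  apply/pcharf0P => -[|j]; first by rewrite mulr0n !eqxx.
  apply/negP => /eqP; rewrite -(rmorph_nat phi) => /phi0 jm.
  case: m_maximal => /negP[].
  have -> : 1 = ((j.+1%:R^-1 : K) *: 1) * j.+1%:R :> R.
    rewrite -scalerAl mul1r.
    have <- : (j.+1%:R : K) *: 1 = j.+1%:R :> R by apply: scaler_nat.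
    by rewrite scalerA mulVf // scale1r.
  exact: Defs.idealMl.
set I := ext_ideal m iota_central.
have [pi [pi_onto pi0]] := ring_quot_projection I.
have I_coords x : x \in I <-> map_mx phi (C x) = 0.
  split=> [/asboolP[s sm ->]|Cx0].
    rewrite raddf_sum raddf_sum big_seq big1 //= => p /sm /phi0 p0.
    have -> : C (iota p.1 * p.2) = p.1 *: C p.2 by case: (C_acts p.1).
    by rewrite map_mxZ p0 scale0r.
  apply/asboolP; exists [seq (C x 0 i, cb C i) | i <- enum 'I_n.+1].
    move=> _ /mapP[i _ ->]; apply/phi0.
    by have /rowP/(_ i) := Cx0; rewrite !mxE.
  by rewrite big_map big_enum /= -C_basis.
have Q10 : 1 != 0 :> ring_quot I.
  apply/eqP; rewrite -(rmorph1 pi) => /pi0 I1.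
  have /I_coords/rowP/(_ ord0) : cb C ord0 \in I.
    by rewrite -[cb C ord0]mulr1; apply: Defs.idealMl.
  by rewrite co_cb !mxE !eqxx rmorph1 => /eqP; rewrite oner_eq0.
pose A : nzRingType := HB.pack_for nzRingType (ring_quot I)
  (GRing.PzSemiRing_isNonZero.Build (ring_quot I) Q10).
pose piA : {rmorphism H -> A} := pi.
have pi_ker x : piA x = 0 <-> map_mx phi (C x) = 0.
  by rewrite -I_coords -pi0.
have [kap [kapC kap_phi]] :=
  reduced_scalars iota_central C_acts phi_onto (pi := piA) pi_onto pi_ker.
have [CA [CA_acts CA_basis CA_bitrace]] :=
  reduced_coords C_acts C_basis phi_onto (pi := piA) pi_onto pi_ker kapC kap_phi.
suff : rank_one_property A by [].
apply: (rank_one_of_central_part (N := N) k_char0 CA_acts CA_basis) => y.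
have [x <-] := pi_onto y; have [t [tC tE]] := central_part x.
exists (piA t); split=> z; have [w <-] := pi_onto z.
  by rewrite -!(rmorphM piA) tC.
by rewrite !CA_bitrace -tE rmorphMn.
Qed.
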